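(* Let $m,n,d\ge1$ with $\gcd(m,n)=1$, and let $C$ be a plane curve singularity over $\mathbb{C}$ with parametrization $(x(t),y(t))=(t^{nd},t^{md}+\lambda t^{md+1}+\ldots)$, $\lambda\neq0$. Let $\Delta\subset\mathbb{Z}_{\ge0}$ be a cofinite $(nd,md)$-invariant subset which is admissible. Then the stratum $J_\Delta\subset\overline{JC}$ is isomorphic to the affine space of dimension $$\dim J_\Delta=\sum_{j=0}^{d-1}\sum_{i=0}^{n-1}\left(|\mathrm{Gaps}(a_{j,i})|-|\mathrm{Gaps}(a_{j,i}+md)|\right),$$ where $\mathrm{Gaps}(x)=[x,+\infty)\setminus\Delta$ (integer points) and $a_{j,i}$ are the $(nd)$-generators of $\Delta$.
   Context: A subset $\Delta\subset\mathbb{Z}_{\ge0}$ is cofinite if $\mathbb{Z}_{\ge0}\setminus\Delta$ is finite, and $(nd,md)$-invariant if $\Delta+nd\subset\Delta$ and $\Delta+md\subset\Delta$. An $(nd)$-generator of $\Delta$ is an $a\in\Delta$ with $a-nd\notin\Delta$; for cofinite $\Delta$ there is exactly one in each residue class mod $nd$, and those congruent to $j$ mod $d$ are denoted $a_{j,0},\dots,a_{j,n-1}$ ($j=0,\dots,d-1$). $\Delta$ is called admissible if for every $j$ there exists $i$ with $a_{j,i}+md+1\in\Delta$. Let $\mathcal{O}_C=\mathbb{C}[[x(t),y(t)]]\subset\mathbb{C}((t))$. For $M\subset\mathbb{C}((t))$ let $\Delta_M=\{\mathrm{Ord} f: 0\neq f\in M\}$, where $\mathrm{Ord} f$ is the lowest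 exponent of $t$ occurring in $f$ with nonzero coefficient. The stratum is $J_\Delta=\{M\subset\mathbb{C}((t)):\ \mathcal{O}_CM\subset M,\ \Delta_M=\Delta\}$ (closed $\mathbb{C}$-subspaces $M$). It is regarded as a stratum of the compactified Jacobian $\overline{JC}$ (the variety of $\mathcal{O}_C$-submodules $M\subset t^{-N}\mathbb{C}[[t]]$, $N\gg 0$, with $\dim t^{-N}\mathbb{C}[[t]]/M=\dim t^{-N}\mathbb{C}[[t]]/\mathcal{O}_C$) after multiplying $M$ by a suitable power of $t$, which does not change $J_\Delta$ up to isomorphism. *)

(* Defs.v *)
From mathcomp Require Export all_boot all_order all_algebra.
From mathcomp Require Export finmap complex.
From mathcomp Require Export mpoly.
From mathcomp Require Export boolp classical_sets functions cardinality fsbigop.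
From mathcomp Require Export reals.

Set Implicit Arguments.
Unset Strict Implicit.
Unset Printing Implicit Defensive.

Import Order.TTheory GRing.Theory Num.Theory.

Local Open Scope classical_set_scope.
Local Open Scope ring_scope.

(** * Laurent series, the ring of the curve and its modules *)

Section Laurent.
Variable K : fieldType.

(* A formal Laurent series is represented by its coefficient function
   int -> K; [tpow N] is t^N K[[t]], so [laurent] is K((t)). *)
Definition tpow (N : int) : set (int -> K) :=
  [set f | forall k : int, k < N -> f k = 0].

Definition laurent : set (int -> K) := [set f | exists N : int, tpow N f].

Definition monom (a : int) : int -> K := fun k => (k == a)%:R.

(* For f and g in K((t)) the sum below has finite support. *)
Definition lmul (f g : int -> K) : int -> K :=
  fun k => \sum_(i \in [set: int]) f i * g (k - i).

Definition lexp (f : int -> K) (i : nat) : int -> K :=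
  iter i (lmul f) (monom 0).

(* K[[x, y]] for x, y in tK[[t]]: the series \sum_(i, j) c i j x^i y^j.  Since
   x^i y^j lies in t^(i+j) K[[t]], each coefficient is a finite sum. *)
Definition curve_ring (x y : int -> K) : set (int -> K) :=
  [set f | exists c : nat -> nat -> K, forall k : int,
     f k = \sum_(p \in [set: nat * nat])
              c p.1 p.2 * lmul (lexp x p.1) (lexp y p.2) k].

Definition subspace (M : set (int -> K)) : Prop :=
  M (fun=> 0) /\
  forall (b : K) (f g : int -> K), M f -> M g -> M (fun k => b * f k + g k).

(* closed in K((t)) for the t-adic topology *)
Definition tclosed (M : set (int -> K)) : Prop :=
  forall f, laurent f ->
    (forall N : int, exists2 g, M g & tpow N (fun k => f k - g k)) -> M f.

Definition curve_module (x y : int -> K) (M : set (int -> K)) : Prop :=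
  [/\ M `<=` laurent, subspace M, tclosed M &
      forall g f, curve_ring x y g -> M f -> M (lmul g f)].

Definition has_ord (f : int -> K) (a : int) : Prop := f a != 0 /\ tpow a f.

Definition ord_set (M : set (int -> K)) : set int :=
  [set a | exists2 f, M f & has_ord f a].

Definition J_stratum (x y : int -> K) (Delta : set nat) :
    set (set (int -> K)) :=
  [set M | curve_module x y M /\ ord_set M = Posz @` Delta].

(* dim (t^(-N) K[[t]] / M) = c: the classes of e_0, ..., e_(c-1) form a basis
   of the quotient. *)
Definition has_codim (N : nat) (M : set (int -> K)) (c : nat) : Prop :=
  exists e : 'I_c -> int -> K,
    (forall i, tpow (- N%:Z) (e i)) /\
    forall f, tpow (- N%:Z) f ->
      exists! u : 'rV[K]_c, M (fun k => f k - \sum_(i < c) u 0 i * e i k).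

Definition comp_jacobian (x y : int -> K) (N : nat) : set (set (int -> K)) :=
  [set M | [/\ curve_module x y M, M `<=` tpow (- N%:Z) &
     exists2 c, has_codim N (curve_ring x y) c & has_codim N M c]].

(* t^s M *)
Definition shift (s : int) (M : set (int -> K)) : set (int -> K) :=
  [set (fun k : int => f (k - s)) | f in M].

(* J_Delta as a stratum of the compactified Jacobian: the translates t^s M of
   the elements M of J_Delta that lie in it.  The codimension condition
   determines s from Delta, so this is t^s J_Delta for a single s. *)
Definition JC_stratum (x y : int -> K) (Delta : set nat) (N : nat) :
    set (set (int -> K)) :=
  comp_jacobian x y N `&`
  [set M' | exists s : int, exists2 M, J_stratum x y Delta M & M' = shift s M].

End Laurent.

(** * The variety structure *)

Section Varieties.
Variable K : fieldType.

(* Points M of a set X of points of a projective space are given by their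
   homogeneous coordinates, indexed by a finite type T: [hc M v] says that the
   nonzero vector v represents M.  A polynomial in these coordinates has
   variables indexed by 'I_#|T|. *)
Variables (Y : Type) (T : finType) (hc : Y -> set (T -> K)).

Definition hev (P : {mpoly K[#|T|]}) (v : T -> K) : K :=
  P.@[fun i => v (enum_val i)].

(* Near each point of X, h is a quotient of two forms of the same degree. *)
Definition regular_on (X : set Y) (h : Y -> K) : Prop :=
  forall M, X M -> exists (e : nat) (P Q : {mpoly K[#|T|]}),
    [/\ P \is e.-homog, Q \is e.-homog,
        (exists2 v, hc M v & hev Q v != 0) &
        forall M' v, X M' -> hc M' v -> hev Q v != 0 ->
          h M' = hev P v / hev Q v].

(* Near each point of affine space, phi is given by polynomial homogeneous
   coordinates without common zero. *)
Definition morphism_from_affine (D : nat) (phi : 'rV[K]_D -> Y) : Prop :=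
  forall u : 'rV[K]_D, exists F : T -> {mpoly K[D]},
    (exists t, (F t).@[fun i => u 0 i] != 0) /\
    forall w : 'rV[K]_D, (exists t, (F t).@[fun i => w 0 i] != 0) ->
      hc (phi w) (fun t => (F t).@[fun i => w 0 i]).

(* Mutually inverse morphisms between X and affine D-space.  That X is locally
   closed need not be assumed: if U is an open set of the projective space on
   which psi is given by quotients of forms, X meets U in the closed subset of
   U where phi \o psi is the identity. *)
Definition isomorphic_to_affine_space (X : set Y) (D : nat) : Prop :=
  exists (phi : 'rV[K]_D -> Y) (psi : Y -> 'rV[K]_D),
    [/\ forall u, X (phi u), cancel phi psi,
        forall M, X M -> phi (psi M) = M,
        morphism_from_affine phi &
        forall i, regular_on X (fun M => psi M 0 i)].

End Varieties.

Section Grassmannian.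
Variable K : fieldType.

(* The coordinates of f in t^(-N) K[[t]] / t^N K[[t]]. *)
Definition trunc (N : nat) (f : int -> K) : 'rV[K]_(N + N) :=
  \row_i f (i%:Z - N%:Z).

(* t^N K[[t]] <= M <= t^(-N) K[[t]], and the rows of A are a basis of
   M / t^N K[[t]]. *)
Definition window_basis (N k : nat) (M : set (int -> K))
    (A : 'M[K]_(k, N + N)) : Prop :=
  row_free A /\ M = [set f | tpow (- N%:Z) f /\ (trunc N f <= A)%MS].

(* The Pluecker coordinates of M in Gr(k, t^(-N) K[[t]] / t^N K[[t]]).  The
   k x k minors are indexed by all k-tuples of columns, not only increasing
   ones; the additional coordinates are zero or, up to sign, repetitions. *)
Definition plucker_coord (N k : nat) (M : set (int -> K)) :
    set ({ffun 'I_k -> 'I_(N + N)} -> K) :=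
  [set v | exists (A : 'M[K]_(k, N + N)) (c : K),
     [/\ window_basis M A, c != 0 &
         v = fun s : {ffun 'I_k -> 'I_(N + N)} =>
               c * \det (\matrix_(i, j) A i (s j))]].

End Grassmannian.

(** * Invariant subsets *)

Definition cofinite (Delta : set nat) : Prop := finite_set (~` Delta).

Definition invariant (p q : nat) (Delta : set nat) : Prop :=
  forall a, Delta a -> Delta (a + p)%N /\ Delta (a + q)%N.

Definition generator (p : nat) (Delta : set nat) (a : nat) : Prop :=
  Delta a /\ ~ ((p <= a)%N /\ Delta (a - p)%N).

(* a j 0, ..., a j (n-1) are the (nd)-generators congruent to j mod d, without
   repetition. *)
Definition generators_enum (n d : nat) (Delta : set nat)
    (a : 'I_d -> 'I_n -> nat) : Prop :=
  forall j, injective (a j) /\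
    range (a j) = [set b | generator (n * d) Delta b /\ b = j %[mod d]].

Definition admissible (m n d : nat) (Delta : set nat)
    (a : 'I_d -> 'I_n -> nat) : Prop :=
  forall j, exists i, Delta (a j i + m * d + 1)%N.

Definition gaps (Delta : set nat) (x : nat) : set nat :=
  [set k | (x <= k)%N] `\` Delta.

(* meaningful when Delta is cofinite *)
Definition num_gaps (Delta : set nat) (x : nat) : nat :=
  #|` fset_set (gaps Delta x)|.

(* The subtraction is in nat, but exact when Delta is cofinite:
   gaps Delta (x + m * d) is contained in gaps Delta x. *)
Definition stratum_dim (m n d : nat) (Delta : set nat)
    (a : 'I_d -> 'I_n -> nat) : nat :=
  (\sum_(j < d) \sum_(i < n)
     (num_gaps Delta (a j i) - num_gaps Delta (a j i + m * d)))%N.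

(* Main.v *)
Require Import Defs.
From mathcomp Require Import zify ring.

(** Write p = n d, q = m d and y = t^q (1 + lambda t + ...). Let gen r be the least
    element of Delta in the residue class of r mod p.

    A module M in J_Delta is free over the power series in x, with a unique basis
    of reduced generators f_r = t^(gen r) (1 + sum_(k > 0) c r k t^k), one for each
    residue r mod p, where c r k = 0 unless gen r + k is outside Delta. Conversely,
    an array c defines a point of J_Delta if and only if its span is stable under
    y. For an integer e put f_e = t^e (1 + sum_k c e k t^k), with c extended
    periodically, and expand y f_r = sum_k h r k f_(r + q + k). The condition is
    that h r k = 0 whenever gen r + q + k is outside Delta (gen_module_stratum,
    stratum_gen_module, gen_module_inj). The number of unknowns c r k minus the
    number of these relations is the asserted dimension, and it has to be shown
    that the relations can be solved one after the other.

    The relation of depth k reads c r k - c (r + q) k = (terms of smaller depth).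
    As m and n are coprime, translation by q permutes cyclically the n residues in
    a block, that is, a class mod d. So the relations of depth k in a block are the
    edges of a graph on its unknowns of depth k, and this graph is a union of paths
    or a full cycle. Paths are solved from their ends. A full cycle gives n - 1
    independent conditions, and the sum of its n relations contains no unknown of
    depth k any more. That sum is a condition of depth k - 1: the unknowns of the
    next block enter it linearly with the coefficients - h r 1, where h r 1 =
    lambda + c r 1 - c (r + q) 1. These add up to - n lambda, which is a nonzero
    constant; so adding z to all unknowns of depth k - 1 of the next block changes
    the sum by - n lambda z, and this condition fixes the value at one chosen
    place, the root, while the differences to the root stay as they are. The
    process does not run in a circle: if all blocks were full at depth k, then
    gen r + q + k < gen (r + q + k) for all r, which is absurd, because the values
    of gen on both sides have the same sum over all residues. Admissibility says
    that no block is full at depth 1, where the sum would be the constant n lambda.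
    Hence all relations are used, each determines one unknown as a polynomial in
    the free ones, and the solutions form an affine space of the right dimension
    (solutionP, Pol_solution, count_free).

    In the compactified Jacobian M appears as t^s M. The codimension of a module is
    the number of its gaps, so there is only one possible s (JC_stratumP). Here the
    ring of the curve must have finite codimension. This holds because y^n - x^m
    has order m n d + 1, prime to the order of x (curve_ring_conductor). Finally,
    the truncations of the f_e with e in Delta form a matrix that is unitriangular
    on the columns in Delta. So the maximal minors are polynomials in c, one of them
    being 1, and the coefficients of the reduced generators are ratios of Pluecker
    coordinates (plucker_ratio). *)

Set Implicit Arguments.
Unset Strict Implicit.
Unset Printing Implicit Defensive.

Import Order.TTheory GRing.Theory Num.Theory.
Local Open Scope ring_scope.

(** * Unitriangular systems and periodic sums *)

Section Triangular.
Variable K : pzRingType.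

Fixpoint tsolve_seq (c : nat -> nat -> K) (f : nat -> K) (k : nat) : seq K :=
  if k is k'.+1 then
    let s := tsolve_seq c f k' in
    rcons s (f k' - \sum_(i < k') nth 0 s i * c i k')
  else [::].

(** The solution s of the unitriangular system s k + sum_(i < k) s i * c i k = f
    k. Each value depends on all the previous ones, so the list of these is
    built. *)
Definition tsolve c f k := nth 0 (tsolve_seq c f k.+1) k.

Lemma size_tsolve_seq c f k : size (tsolve_seq c f k) = k.
Proof. by elim: k => //= k IH; rewrite size_rcons IH. Qed.

Lemma nth_tsolve_seq c f k i : (i < k)%N ->
  nth 0 (tsolve_seq c f k) i = tsolve c f i.
Proof.
elim: k => // k IH; rewrite ltnS leq_eqVlt => /orP[/eqP->//|ik].
by rewrite /= nth_rcons size_tsolve_seq ik IH.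
Qed.

Lemma tsolveE c f k :
  tsolve c f k + \sum_(i < k) tsolve c f i * c i k = f k.
Proof.
rewrite {1}/tsolve /= nth_rcons size_tsolve_seq ltnn eqxx.
rewrite (eq_bigr (fun i : 'I_k => tsolve c f i * c i k)) ?subrK//.
by move=> i _; rewrite nth_tsolve_seq.
Qed.

Lemma tsolve_unique (c : nat -> nat -> K) (f b b' : nat -> K) N :
  (forall k, (k < N)%N -> b k + \sum_(i < k) b i * c i k = f k) ->
  (forall k, (k < N)%N -> b' k + \sum_(i < k) b' i * c i k = f k) ->
  forall k, (k < N)%N -> b k = b' k.
Proof.
move=> bE b'E; elim/ltn_ind => k IH kN.
apply: (@addIr _ (\sum_(i < k) b i * c i k)); rewrite bE//.
rewrite -(b'E k)//; congr (_ + _); apply: eq_bigr => i _.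
by rewrite IH// (ltn_trans _ kN).
Qed.

End Triangular.

Lemma sum_shift (V : nmodType) p s (F : nat -> V) :
  (forall r, F (r + p)%N = F r) -> \sum_(r < p) F (r + s)%N = \sum_(r < p) F r.
Proof.
move=> Fp; elim: s => [|s IH]; first by apply: eq_bigr => r _; rewrite addn0.
rewrite -IH; case: p Fp {IH} => [|p] Fp; first by rewrite !big_ord0.
rewrite big_ord_recr big_ord_recl /= addrC; congr (_ + _).
  by rewrite -(Fp s); congr F; lia.
by apply: eq_bigr => r _; congr F; rewrite /bump /=; lia.
Qed.

Lemma sum_modn_eq n d j : (0 < d)%N ->
  (\sum_(r < n * d | r %% d == j %% d) 1 = n)%N.
Proof.
move=> d0; elim: n => [|n IH]; first by rewrite mul0n big_ord0.
rewrite mulSn big_split_ord /=.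
rewrite (eq_bigl (fun i : 'I_(n * d) => i %% d == j %% d)%N) ?IH; last first.
  by move=> i; rewrite modnDl.
rewrite (big_pred1 (Ordinal (ltn_pmod j d0)))//= => i.
by rewrite /= modn_small.
Qed.

(** * The graph of unknowns and relations *)

Section Combinatorics.
Variables (m n d : nat) (gen : nat -> nat).
Local Notation p := (n * d)%N.
Local Notation q := (m * d)%N.

(** With gen r the least element of Delta in the class of r mod p, gen r + k is
    outside Delta: the reduced generator of order gen r may have a nonzero
    coefficient c r k there. *)
Definition vertex r k := (gen r + k < gen (r + k))%N.

(** gen r + q + k is outside Delta: the product of y with the generator of order
    gen r gives a relation of depth k. Among the unknowns of depth k it contains
    those at r and at r + q, and is viewed as an edge between them. *)
Definition edge r k := (gen r + q + k < gen (r + q + k))%N.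

(** The blocks are the classes mod d, of n residues mod p each. *)
Definition same_block r j := (r %% d == j %% d)%N.

(** The edges of depth k form a cycle through the whole block. *)
Definition full j k := [forall r : 'I_p, same_block r j ==> edge r k].

(** The previous block is full at depth k.+1. The sum of its relations is then a
    condition on the unknowns of depth k in this block. *)
Definition linked j k := [forall r : 'I_p, same_block r.+1 j ==> edge r k.+1].

(** The unknowns of a block are measured from that at its root. This is a vertex
    without outgoing edge if there is one. Otherwise, unless the block has no
    vertex, its edges form a cycle, which is cut open at the root. *)
Definition root j k : nat :=
  if [pick r : 'I_p | [&& same_block r j, vertex r k & ~~ edge r k]] is Some r
  then r
  else if [pick r : 'I_p | same_block r j && vertex r k] is Some r
  then r else (j %% d)%N.

(** The point where the cyclic succession of blocks is cut open. *)
Definition first_block k : nat :=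
  if [pick j : 'I_d | ~~ linked j k] is Some j then j else 0%N.

Hypothesis n_gt0 : (0 < n)%N.
Hypothesis d_gt0 : (0 < d)%N.
Hypothesis gen_per : forall r, gen (r + p)%N = gen r.
Hypothesis gen_inv : forall r, (gen (r + q) <= gen r + q)%N.
Hypothesis gen_adm : forall j, exists2 r, same_block r j &
  (gen (r + q + 1) <= gen r + q + 1)%N.

Lemma period_gt0 : (0 < p)%N. Proof. by rewrite muln_gt0 n_gt0. Qed.

Lemma same_block_refl r : same_block r r. Proof. exact: eqxx. Qed.

Lemma same_block_sym r s : same_block r s = same_block s r.
Proof. exact: eq_sym. Qed.

Lemma same_block_trans s r t : same_block r s -> same_block s t -> same_block r t.
Proof. by move=> /eqP rs /eqP st; apply/eqP; rewrite rs. Qed.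

Lemma same_block_addmul r i : same_block (r + i * d) r.
Proof. by rewrite /same_block addnC modnMDl. Qed.

Lemma same_block_addq r : same_block (r + q) r.
Proof. by rewrite /same_block addnC modnMDl. Qed.

Lemma same_blockD r s t : same_block (r + t) (s + t) = same_block r s.
Proof. by rewrite /same_block eqn_modDr. Qed.

Lemma same_block_modp r : same_block (r %% p) r.
Proof. by rewrite /same_block modn_dvdm// dvdn_mull. Qed.

Lemma same_block_modd r : same_block (r %% d) r.
Proof. by rewrite /same_block modn_mod. Qed.

Section Periodic.
Variables (T : Type) (F : nat -> T).
Hypothesis Fp : forall r, F (r + p)%N = F r.

Lemma per_muln r i : F (r + i * p)%N = F r.
Proof.
by elim: i => [|i IH]; rewrite ?mul0n ?addn0// mulSn addnCA addnC Fp.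
Qed.

Lemma per_modn r : F (r %% p)%N = F r.
Proof. by rewrite [in RHS](divn_eq r p) addnC per_muln. Qed.

Lemma per_eqmod r s : r = s %[mod p] -> F r = F s.
Proof. by move=> rs; rewrite -per_modn rs per_modn. Qed.
End Periodic.

Lemma addnACp r k : (r + p + k = r + k + p)%N. Proof. by rewrite addnAC. Qed.

Lemma vertex_per k r : vertex (r + p) k = vertex r k.
Proof. by rewrite /vertex gen_per addnACp gen_per. Qed.

Lemma edge_per k r : edge (r + p) k = edge r k.
Proof. by rewrite /edge gen_per addnACp addnACp gen_per. Qed.

(** Both ends of an edge are vertices, because Delta is stable under addition of
    q. *)
Lemma edge_source r k : edge r k -> vertex r k.
Proof.
rewrite /edge /vertex => rk; have := gen_inv (r + k).
by rewrite addnAC in rk; move: rk; rewrite (addnAC r); lia.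
Qed.

Lemma edge_target r k : edge r k -> vertex (r + q) k.
Proof. by rewrite /edge /vertex => rk; have := gen_inv r; lia. Qed.

Lemma edge0 r : ~~ edge r 0.
Proof. by rewrite /edge !addn0 -leqNgt. Qed.

Lemma vertex0 r : ~~ vertex r 0.
Proof. by rewrite /vertex !addn0 ltnn. Qed.

Lemma fullP j k : reflect (forall r, same_block r j -> edge r k) (full j k).
Proof.
apply: (iffP forallP) => [f r rj|f r]; last by apply/implyP => /f.
have /implyP := f (Ordinal (ltn_pmod r period_gt0)).
rewrite /= (per_modn (edge_per k)); apply.
exact: same_block_trans (same_block_modp r) rj.
Qed.

Lemma linkedP j k :
  reflect (forall r, same_block r.+1 j -> edge r k.+1) (linked j k).
Proof.
apply: (iffP forallP) => [f r rj|f r]; last by apply/implyP => /f.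
have /implyP := f (Ordinal (ltn_pmod r period_gt0)).
rewrite /= (per_modn (edge_per k.+1)); apply.
apply: same_block_trans rj; rewrite -[(r %% p).+1]addn1 -[r.+1]addn1 same_blockD.
exact: same_block_modp.
Qed.

Lemma linkedS j k : linked j.+1 k = full j k.+1.
Proof.
apply/linkedP/fullP => f r rj; apply: f; move: rj;
by rewrite -[r.+1]addn1 -[j.+1]addn1 same_blockD.
Qed.

Lemma full_same j j' k : same_block j j' -> full j k = full j' k.
Proof.
move=> jj'; apply/fullP/fullP => f r rj; apply: f;
  apply: same_block_trans rj _ => //; by rewrite same_block_sym.
Qed.

Lemma linked_same j j' k : same_block j j' -> linked j k = linked j' k.
Proof.
move=> jj'; apply/linkedP/linkedP => f r rj; apply: f;
  apply: same_block_trans rj _ => //; by rewrite same_block_sym.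
Qed.

(** This is admissibility. *)
Lemma full1 j : ~~ full j 1.
Proof.
apply/negP => /fullP f; have [r /f] := gen_adm j.
by rewrite /edge ltnNge => /negP.
Qed.

Lemma full0 j : ~~ full j 0.
Proof.
apply/negP => /fullP /(_ j (same_block_refl j)); apply/negP; exact: edge0.
Qed.

(** If all blocks were linked, then gen r + q + k + 1 < gen (r + q + k + 1) for
    all r. The sum over r is absurd, since translation by q + k + 1 permutes the
    residues. *)
Lemma not_all_linked k : exists2 j, (j < d)%N & ~~ linked j k.
Proof.
case: (pickP (fun j : 'I_d => ~~ linked j k)) => [j jk|H]; first by exists j.
have all_edge r : edge r k.+1.
  have /negbFE/linkedP := H (Ordinal (ltn_pmod r.+1 d_gt0)).
  by apply; rewrite same_block_sym /=; exact: same_block_modd.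
have : (\sum_(r < p) (gen r + q + k.+1) < \sum_(r < p) gen (r + (q + k.+1))%N)%N.
  rewrite -(prednK period_gt0) !big_ord_recl.
  rewrite -addSn leq_add//=; first by rewrite addnA; exact: all_edge.
  by apply: leq_sum => i _; rewrite addnA ltnW//; exact: all_edge.
have -> : (\sum_(r < p) gen (r + (q + k.+1)) = \sum_(r < p) gen r)%N.
  exact: (@sum_shift nat p (q + k.+1) gen gen_per).
rewrite ltnNge => /negP[]; apply: leq_sum => i _; by rewrite -addnA leq_addr.
Qed.

(** gen r + q + 1 is in Delta and congruent to gen (r + q + 1), hence not
    smaller. So the gap gen r + q + k + 1 is not smaller than gen (r + q + 1) +
    k, which is a gap too since Delta is stable under addition of p. *)
Lemma linked_next j k r : linked j k -> same_block r.+1 j -> ~~ edge r 1 ->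
  vertex (r + q + 1) k.
Proof.
move=> /linkedP lk rj; have := lk r rj; rewrite /edge /vertex -leqNgt.
by rewrite (_ : r + q + 1 + k = r + q + k.+1)%N; lia.
Qed.

Lemma first_blockP k :
  (first_block k < d)%N /\ ~~ linked (first_block k) k.
Proof.
rewrite /first_block; case: pickP => [j|no]; first by split.
by have [j jd] := not_all_linked k; have := no (Ordinal jd); rewrite /= => ->.
Qed.

Hypothesis m_gt0 : (0 < m)%N.
Hypothesis mn_coprime : coprime m n.

(** Bezout: as m is prime to n, translation by q permutes each block cyclically. *)
Lemma reach r s : same_block r s -> exists2 i, (i < n)%N & r + i * q = s %[mod p].
Proof.
move=> /eqP rs.
have [u um] : exists u, (u * m = 1 %[mod n])%N.
  have /(coprimeP _ m_gt0)[[u v]/= uv] := mn_coprime.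
  have E : (u * m = v * n + 1)%N by lia.
  by exists u; rewrite E modnMDl.
have rsp : (r <= s + p * r)%N.
  by apply: leq_trans (leq_addl _ _); rewrite leq_pmull ?period_gt0.
have dx : (d %| s + p * r - r)%N.
  rewrite -eqn_mod_dvd// (_ : p * r = n * r * d)%N; last by ring.
  by rewrite addnC modnMDl rs.
have [x xE] := dvdnP dx.
exists ((u * x) %% n)%N; first by rewrite ltn_mod.
have -> : r + (u * x) %% n * q = r + (u * x) * q %[mod p].
  apply/eqP; rewrite eqn_modDl mulnA [X in _ == X %[mod _]]mulnA.
  by rewrite -!muln_modl; apply/eqP; congr (_ * _)%N; rewrite modnMml.
have -> : r + u * x * q = r + x * d %[mod p].
  apply/eqP; rewrite eqn_modDl (_ : u * x * q = u * m * x * d)%N; last by ring.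
  rewrite -!muln_modl; apply/eqP; congr (_ * _)%N.
  by rewrite -modnMml um modnMml mul1n.
by rewrite -xE subnKC// addnC mulnC modnMDl.
Qed.

Lemma root_block j k : same_block (root j k) j.
Proof.
rewrite /root; case: pickP => [r /and3P[]//|_].
by case: pickP => [r /andP[]//|_]; exact: same_block_modd.
Qed.

Lemma root_lt j k : (root j k < p)%N.
Proof.
rewrite /root; case: pickP => [r _//|_]; case: pickP => [r _//|_].
by apply: leq_trans (ltn_pmod _ d_gt0) _; rewrite leq_pmull.
Qed.

Lemma pick_block j (P : pred nat) :
  (forall r, P (r + p)%N = P r) ->
  (forall r : 'I_p, same_block r j && P r = false) ->
  forall r, same_block r j -> ~~ P r.
Proof.
move=> Pp no r rj; rewrite -(per_modn Pp).
have := no (Ordinal (ltn_pmod r period_gt0)); rewrite /=.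
by rewrite (same_block_trans (same_block_modp r) rj) /= => ->.
Qed.

Lemma root_vertex j k r : same_block r j -> vertex r k -> vertex (root j k) k.
Proof.
rewrite /root; case: pickP => [s /and3P[]//|_].
case: pickP => [s /andP[]//|no] rj rk.
have := pick_block (P := vertex^~ k) (vertex_per k) no rj.
by rewrite rk.
Qed.

(** The root has an outgoing edge only if every vertex of the block has one. *)
Lemma root_edge j k : edge (root j k) k -> full j k.
Proof.
move=> rk; have rb := root_block j k; have rp := edge_source rk.
have step r : same_block r j -> vertex r k -> edge r k.
  move: rk; rewrite /root; case: pickP => [s /and3P[_ _ /negPf->]//|no _] rj rk.
  have := pick_block (P := fun r => vertex r k && ~~ edge r k) _ no rj.
  by rewrite rk /= negbK; apply=> s; rewrite vertex_per edge_per.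
apply/fullP => r rj; apply: (step) => //.
(* The ends of edges are vertices, so the walk from the root never stops. *)
have [i _ iE] := reach (same_block_trans rb (etrans (same_block_sym _ _) rj)).
rewrite -(per_eqmod (vertex_per k) iE); elim: i {iE} => [|i IH].
  by rewrite addn0.
rewrite mulSn addnCA addnC; apply: edge_target; apply: (step) IH.
by apply: same_block_trans rb; rewrite /same_block addnC mulnA modnMDl.
Qed.

Lemma same_blockSD r j i : same_block (r + i * d).+1 j = same_block r.+1 j.
Proof. by rewrite /same_block -addSn [(_ + i * d)%N]addnC modnMDl. Qed.

(** The unknowns that serve as parameters: the ends of the paths formed by the
    edges, through their difference to the root, and the roots that are not
    fixed by a link. *)
Definition free r k :=
  vertex r k && (if (r %% p)%N == root r k then ~~ linked r k else ~~ edge r k).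

(** A crude bound for the distance from a generator to a gap. *)
Definition depth := (\sum_(r < p) gen r)%N.

Lemma vertex_depth r k : vertex r k -> (k <= depth)%N.
Proof.
rewrite /vertex => rk; apply: (@leq_trans (gen (r + k))); first by lia.
rewrite -(per_modn gen_per) /depth.
rewrite (bigD1 (Ordinal (ltn_pmod (r + k) period_gt0)))//=.
exact: leq_addr.
Qed.

Lemma root_same j j' k : same_block j j' -> root j k = root j' k.
Proof.
move=> /eqP jj'; rewrite /root jj'.
have E r : same_block r j = same_block r j' by rewrite /same_block jj'.
rewrite (eq_pick (Q := fun r : 'I_p => [&& same_block r j', vertex r k & ~~ edge r k])).
  case: pickP => // _.
  rewrite (eq_pick (Q := fun r : 'I_p => same_block r j' && vertex r k))// => r.
  by rewrite E.
by move=> r; rewrite E.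
Qed.

(** By admissibility linked_next applies to some residue of the previous block. *)
Lemma linked_vertex j k : linked j k -> vertex (root j k) k.
Proof.
move=> lk; have [r rj radm] := gen_adm (j + d.-1).
have rj' : same_block r.+1 j.
  rewrite -(same_blockD _ _ d.-1); apply: same_block_trans rj.
  by rewrite (_ : r.+1 + d.-1 = r + 1 * d)%N; [exact: same_block_addmul|lia].
have rq : same_block (r + q + 1) j by rewrite addn1 same_blockSD.
by apply: root_vertex rq _; apply: (linked_next lk rj'); rewrite /edge -leqNgt.
Qed.

Lemma sum_roots k (P : nat -> nat) :
  (forall r s, same_block r s -> P r = P s) ->
  (\sum_(r < p) (r == root r k :> nat) * P r = \sum_(j < d) P j)%N.
Proof.
move=> Pb.
transitivity (\sum_(r < p) \sum_(j < d) (r == root j k :> nat) * P j)%N.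
  apply: eq_bigr => r _.
  rewrite (bigD1 (Ordinal (ltn_pmod r d_gt0)))//= big1 ?addn0.
    have rr := same_block_modd r.
    by rewrite (root_same _ rr) (Pb _ _ rr).
  move=> j /eqP jr; case: eqVneq => // rr; case: jr; apply: val_inj => /=.
  have := root_block j k; rewrite -rr /same_block => /eqP ->.
  by rewrite modn_small.
rewrite exchange_big; apply: eq_bigr => j _ /=.
have rl : (root j k < p)%N by exact: root_lt.
rewrite (bigD1 (Ordinal rl))//= eqxx mul1n big1 ?addn0//.
by move=> r /eqP rr; case: eqVneq => // e; case: rr; exact: val_inj.
Qed.

(** Away from the root, a vertex is either free or the source of an edge. The
    root is free unless its block is linked, and is the source of an edge only
    if its block is full. *)
Lemma count_level k :
  (\sum_(r < p) free r k + \sum_(r < p) edge r k + \sum_(j < d) linked j k =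
   \sum_(r < p) vertex r k + \sum_(j < d) full j k)%N.
Proof.
rewrite -(@sum_roots k (fun j => linked j k)) => [|r s rs]; last first.
  by rewrite (@linked_same _ _ _ rs).
rewrite -(@sum_roots k (fun j => full j k)) => [|r s rs]; last first.
  by rewrite (@full_same _ _ _ rs).
rewrite -!big_split /=; apply: eq_bigr => r _; rewrite /free (modn_small (ltn_ord r)).
have [rr|rr] := eqVneq (r : nat) (root r k); last first.
  have [rk|rk] := boolP (vertex r k); first by case: (edge r k).
  by have [/edge_source|//] := boolP (edge r k); rewrite (negPf rk).
have -> : edge r k = full r k.
  apply/idP/idP => [re|/fullP]; last by apply; exact: same_block_refl.
  by apply: root_edge; rewrite -rr.
have [rk|rk] := boolP (vertex r k); first by case: (linked r k); case: (full r k).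
have [/linked_vertex|_] := boolP (linked r k); first by rewrite -rr (negPf rk).
by rewrite !mul1n /=; case: (full r k).
Qed.

(** A full block of depth k.+1 makes the next block linked at depth k: its
    superfluous relation is the one that removes a parameter there. No block is
    full at depth 0 or 1 or beyond all gaps, so the two corrections of
    count_level cancel in the sum over k. *)
Lemma count_free :
  (\sum_(r < p) \sum_(k < depth.+1) free r k +
   \sum_(r < p) \sum_(k < depth.+1) edge r k =
   \sum_(r < p) \sum_(k < depth.+1) vertex r k)%N.
Proof.
pose L k := (\sum_(j < d) linked j k)%N; pose F k := (\sum_(j < d) full j k)%N.
have LF k : L k = F k.+1.
  rewrite /L -(@sum_shift nat d 1 (fun j => linked j k : nat)).
    by apply: eq_bigr => j _; rewrite addn1 linkedS.
  move=> j; congr nat_of_bool.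
  apply: linked_same.
  by rewrite /same_block modnDr.
have F0 : F 0%N = 0%N by apply: big1 => j _; rewrite (negPf (full0 j)).
have FD : F depth.+1 = 0%N.
  apply: big1 => j _; have [/fullP H|//] := boolP (full j _).
  by have /edge_source/vertex_depth := H j (same_block_refl _); rewrite ltnn.
have LFs : (\sum_(k < depth.+1) L k = \sum_(k < depth.+1) F k)%N.
  rewrite (eq_bigr (fun k : 'I_depth.+1 => F k.+1)) => [|k _]; last exact: LF.
  by rewrite [RHS]big_ord_recl big_ord_recr /= FD F0 addn0.
have : (\sum_(k < depth.+1) (\sum_(r < p) free r k + \sum_(r < p) edge r k + L k) =
        \sum_(k < depth.+1) (\sum_(r < p) vertex r k + F k))%N.
  by apply: eq_bigr => k _; exact: count_level.
rewrite !big_split /= LFs => /addIn.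
have ex (G : nat -> nat -> nat) :
    (\sum_(r < p) \sum_(k < depth.+1) G r k = \sum_(k < depth.+1) \sum_(r < p) G r k)%N.
  by rewrite exchange_big.
by rewrite (ex (fun r k => free r k)) (ex (fun r k => edge r k)) (ex (fun r k => vertex r k)).
Qed.

End Combinatorics.

(** * The relations *)

Section Relations.
Variables (K : fieldType) (q : nat) (lam : nat -> K).

(** The coefficients of y f_r = sum_k h_k f_(r + q + k), where y = t^q sum_k lam
    k t^k and f_e = t^e sum_k c e k t^k. Comparing the coefficients of powers of
    t gives a unitriangular system. *)
Definition ycoef (c : nat -> nat -> K) (r : nat) : nat -> K :=
  tsolve (fun i k => c (r + q + i)%N (k - i)%N)
         (fun k => \sum_(i < k.+1) lam i * c r (k - i)%N).

Lemma ycoefE c r k :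
  ycoef c r k = \sum_(i < k.+1) lam i * c r (k - i)%N
                - \sum_(i < k) ycoef c r i * c (r + q + i)%N (k - i)%N.
Proof.
pose cc i k := c (r + q + i)%N (k - i)%N.
pose f k := \sum_(i < k.+1) lam i * c r (k - i)%N.
by apply/esym/eqP; rewrite subr_eq; apply/eqP; exact: esym (tsolveE cc f k).
Qed.

Lemma ycoef0 c r : lam 0%N = 1 -> c r 0%N = 1 -> ycoef c r 0 = 1.
Proof. by move=> l0 c0; rewrite ycoefE big_ord0 big_ord1 subr0 l0 c0 mulr1. Qed.

Lemma ycoef_per p c : (forall r k, c (r + p)%N k = c r k) ->
  forall k r, ycoef c (r + p) k = ycoef c r k.
Proof.
move=> cp; elim/ltn_ind => k IH r; rewrite !ycoefE; congr (_ - _).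
  by apply: eq_bigr => i _; rewrite cp.
apply: eq_bigr => i _; rewrite IH//; congr (_ * _).
by rewrite -(cp (r + q + i)%N); congr c; lia.
Qed.

Hypothesis lam0 : lam 0%N = 1.

(** In ycoefE, unknowns of depth k occur only in the terms with i = 0, hence
    only at r and at r + q. *)
Lemma ycoef_agree c b r k :
  (forall s i, (i < k)%N -> c s i = b s i) -> c r k = b r k ->
  c (r + q)%N k = b (r + q)%N k -> forall i, (i <= k)%N ->
  ycoef c r i = ycoef b r i.
Proof.
move=> low ck ckq; elim/ltn_ind => i IH ik; rewrite !ycoefE; congr (_ - _).
  apply: eq_bigr => -[e /= ei] _; congr (_ * _).
  by case: e ei => [|e] ei; [case: (ltngtP i k) ik => // [ik _|-> _]; rewrite ?subn0// low| rewrite low//; lia].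
apply: eq_bigr => -[e /= ei] _; rewrite IH//; last by lia.
congr (_ * _); case: e ei => [|e] ei; last by rewrite low//; lia.
rewrite addn0 subn0; case: (ltngtP i k) ik => // [ik _|-> _//]; by rewrite low.
Qed.

Lemma ycoefS c r k : c r 0%N = 1 ->
  ycoef c r k.+1 = c r k.+1 - c (r + q)%N k.+1
    + \sum_(i < k.+1) lam i.+1 * c r (k - i)%N
    - \sum_(i < k) ycoef c r i.+1 * c (r + q + i.+1)%N (k - i)%N.
Proof.
move=> c0; rewrite ycoefE [in LHS]big_ord_recl [X in _ - X]big_ord_recl /=.
rewrite !subn0 addn0 lam0 mul1r ycoef0// mul1r opprD addrACA addrA.
by congr (_ + _ - _); apply: eq_bigr => i _.
Qed.

(** A relation contains the unknowns of its own depth only through a difference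
    along the edge. *)
Lemma ycoef_top c b r k : (0 < k)%N ->
  (forall s, c s 0%N = 1) -> (forall s, b s 0%N = 1) ->
  (forall s i, (i < k)%N -> c s i = b s i) ->
  ycoef c r k - ycoef b r k =
  (c r k - b r k) - (c (r + q)%N k - b (r + q)%N k).
Proof.
case: k => // k _ c0 b0 low; rewrite !ycoefS//.
rewrite (eq_bigr (fun i : 'I_k.+1 => lam i.+1 * b r (k - i)%N)); last first.
  by move=> i _; rewrite low// ltnS leq_subr.
rewrite [X in _ - X - _](eq_bigr (fun i : 'I_k =>
  ycoef b r i.+1 * b (r + q + i.+1)%N (k - i)%N)); first by ring.
move=> i _; rewrite low ?ltnS ?leq_subr//; congr (_ * _).
by apply: (@ycoef_agree c b r k) => //; do ?[move=> *; apply: low; lia].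
Qed.

(** One depth up, a relation contains the unknowns of depth k of the next block
    linearly, with coefficient - ycoef c r 1. These are the unknowns that a full
    block determines. *)
Lemma ycoef_next c b r k : (0 < k)%N ->
  (forall s, c s 0%N = 1) -> (forall s, b s 0%N = 1) ->
  (forall s i, (i < k)%N -> c s i = b s i) -> c r k = b r k ->
  c (r + q)%N k = b (r + q)%N k ->
  ycoef c r k.+1 - ycoef b r k.+1 =
  (c r k.+1 - b r k.+1) - (c (r + q)%N k.+1 - b (r + q)%N k.+1)
  - ycoef c r 1 * (c (r + q + 1)%N k - b (r + q + 1)%N k).
Proof.
case: k => // k _ c0 b0 low ck ckq.
rewrite (ycoefS k.+1 (c0 r)) (ycoefS k.+1 (b0 r)).
rewrite (eq_bigr (fun i : 'I_k.+2 => lam i.+1 * b r (k.+1 - i)%N)); last first.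
  move=> -[[|i] /= ik] _; first by rewrite subn0 ck.
  by rewrite low//; lia.
rewrite [X in _ - X - _]big_ord_recl [X in _ - (_ - X)]big_ord_recl /= subn0.
rewrite (ycoef_agree low ck ckq (i := 1))//.
rewrite [X in _ - (_ + X) - _](eq_bigr (fun i : 'I_k =>
  ycoef b r (lift ord0 i).+1 * b (r + q + (lift ord0 i).+1)%N (k.+1 - lift ord0 i)%N)).
  by rewrite /=; ring.
move=> i _; rewrite low; last by rewrite /= /bump /=; lia.
congr (_ * _); apply: (@ycoef_agree c b r k.+1) => //.
by rewrite /= /bump /=; have := ltn_ord i; lia.
Qed.

End Relations.

(** * Triangular solution of the relations *)

Section Solution.
Variables (K : fieldType) (m n d : nat) (gen : nat -> nat) (lam : nat -> K).
Local Notation p := (n * d)%N.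
Local Notation q := (m * d)%N.
Local Notation vertex := (vertex gen).
Local Notation edge := (edge m d gen).
Local Notation same_block := (same_block d).
Local Notation full := (full m n d gen).
Local Notation linked := (linked m n d gen).
Local Notation root := (root m n d gen).
Local Notation first_block := (first_block m n d gen).
Local Notation ycoef := (ycoef q lam).
Local Notation free := (free m n d gen).
Local Notation depth := (depth n d gen).

(** The arrays of coefficients of reduced generators, extended periodically. *)
Definition normalized (c : nat -> nat -> K) :=
  [/\ forall r, c r 0%N = 1, forall r k, c (r + p)%N k = c r k
    & forall r k, (0 < k)%N -> ~~ vertex r k -> c r k = 0].

(** The unknowns are determined block by block, those of block t at depth level
    t at stage t. Within each depth the blocks are taken in cyclic order from
    first_block on, so that a linked block comes right after its predecessor. *)
Definition level t := (t %/ d).+1.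
Definition block t := (t %% d + first_block (level t))%N.
Definition stage r k := (k.-1 * d + (r + (d - first_block k)) %% d)%N.

Section Construction.
Variable w : nat -> nat -> K.

(** The difference to the value at the root, found by following the edges up to
    the root or to a free vertex. A block has n residues, so fuel n suffices. *)
Fixpoint relval (b : nat -> nat -> K) j k fuel r : K :=
  if (r %% p)%N == root j k then 0
  else if edge r k then
    (if fuel is fuel'.+1 then relval b j k fuel' (r + q)%N - ycoef b r k else 0)
  else if vertex r k then w (r %% p)%N k else 0.

Definition active t r k := [&& k == level t, same_block r (block t) & vertex r k].

(** The state after stage t if the root had the value 0. *)
Definition relval_step (b : nat -> nat -> K) t r k : K :=
  if active t r k then relval b (block t) k n r else b r k.

(** In a linked block, adding z to all unknowns subtracts z * (n * lam 1) from
    the sum of the relations of the previous block, whence the quotient. *)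
Definition root_value (b : nat -> nat -> K) t : K :=
  let k := level t in let j := block t in
  if linked j k then
    (\sum_(r < p | same_block r.+1 j) ycoef (relval_step b t) r k.+1)
      / (n%:R * lam 1%N)
  else if vertex (root j k) k then w (root j k) k else 0.

Definition step (b : nat -> nat -> K) t r k : K :=
  if active t r k then relval b (block t) k n r + root_value b t else b r k.

Fixpoint solution t : nat -> nat -> K :=
  if t is t'.+1 then step (solution t') t' else fun _ k => (k == 0%N)%:R.

(** The equations settled at stage t. The relation at the root of a full block
    is not among them. It follows from the second equation at the next block,
    one depth lower. *)
Definition block_eqs (c : nat -> nat -> K) t :=
  let k := level t in let j := block t in
  [/\ forall r, same_block r j -> (r %% p)%N != root j k -> edge r k ->
        ycoef c r k = 0,
      linked j k -> \sum_(r < p | same_block r.+1 j) ycoef c r k.+1 = 0,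
      forall r, same_block r j -> (r %% p)%N != root j k -> vertex r k ->
        ~~ edge r k -> c r k - c (root j k) k = w (r %% p)%N k
    & ~~ linked j k -> vertex (root j k) k -> c (root j k) k = w (root j k) k].

End Construction.

Hypothesis n_gt0 : (0 < n)%N.
Hypothesis d_gt0 : (0 < d)%N.
Hypothesis m_gt0 : (0 < m)%N.
Hypothesis mn_coprime : coprime m n.
Hypothesis gen_per : forall r, gen (r + p)%N = gen r.
Hypothesis gen_inv : forall r, (gen (r + q) <= gen r + q)%N.
Hypothesis gen_adm : forall j, exists2 r, same_block r j &
  (gen (r + q + 1) <= gen r + q + 1)%N.
Hypothesis lam0 : lam 0%N = 1.
Hypothesis nlam1 : n%:R * lam 1%N != 0.

Let fbP k : (first_block k < d)%N /\ ~~ linked (first_block k) k.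
Proof. exact: first_blockP. Qed.

Lemma stageE r k t : (0 < k)%N ->
  (stage r k == t) = (k == level t) && same_block r (block t).
Proof.
case: k => // k _; rewrite /stage /block /level /= eqSS; have [fd _] := fbP k.+1.
have e : ((r + (d - first_block k.+1)) %% d = t %% d)%N <->
    same_block r (t %% d + first_block k.+1)%N.
  split=> [e|/eqP e]; rewrite /same_block.
    by rewrite -e modnDml -addnA subnK 1?ltnW// modnDr.
  rewrite -modnDml e modnDml -addnA subnKC 1?ltnW//.
  by rewrite modnDr modn_mod.
apply/eqP/andP => [et|[/eqP kt]].
  have -> : (t %/ d = k)%N.
    by rewrite -et divnMDl// divn_small ?ltn_pmod// addn0.
  split=> //; apply/e; by rewrite -et modnMDl modn_mod.
by rewrite -kt => /e ->; rewrite kt -divn_eq.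
Qed.

Lemma stage_lt r k : (0 < k)%N -> (stage r k < k * d)%N.
Proof.
by case: k => // k _; rewrite /stage /= mulSn addnC ltn_add2r ltn_pmod.
Qed.

Lemma stage_level r k t : (0 < k)%N -> (k < level t)%N -> (stage r k < t)%N.
Proof.
move=> k0; rewrite /level ltnS => kt; apply: leq_trans (stage_lt r k0) _.
by rewrite -leq_divRL.
Qed.

(** A linked block is not first_block, so it comes right after its predecessor. *)
Lemma stage_prev r t : linked (block t) (level t) ->
  same_block r.+1 (block t) -> (stage r (level t)).+1 = t.
Proof.
move=> lt rt; have : stage r.+1 (level t) == t by rewrite stageE// eqxx.
move/eqP => E; transitivity (stage r.+1 (level t)) => //; rewrite /stage -addnS; congr (_ + _)%N.
have [fd nl] := fbP (level t).
set f := first_block _ in fd nl *; rewrite addSn.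
have := ltn_pmod (r + (d - f)) d_gt0; rewrite leq_eqVlt => /orP[/eqP e|lt'].
  case/negP: nl; rewrite (@linked_same m n d gen n_gt0 d_gt0 gen_per _ (block t))//.
  apply: same_block_trans rt; rewrite /same_block eq_sym.
  have : (r + (d - f) + 1 = 0 %[mod d])%N by rewrite -modnDml addn1 e mod0n modnn.
  move=> e'; apply/eqP; rewrite -(modnDr r.+1 d).
  have -> : (r.+1 + d = (r + (d - f) + 1) + f)%N by lia.
  by rewrite -modnDml e' mod0n.
by rewrite -(modn_small lt') -[in LHS]addn1 modnDml addn1.
Qed.

Lemma active_stage t r k : (0 < k)%N -> active t r k = (stage r k == t) && vertex r k.
Proof. by move=> k0; rewrite stageE// -andbA. Qed.

Lemma active0 t r : active t r 0 = false.
Proof. by rewrite /active. Qed.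

Lemma ycoef_perp c : normalized c -> forall k r, ycoef c (r + p) k = ycoef c r k.
Proof. by case=> _ cp _; apply: ycoef_per. Qed.

Lemma active_per t r k : active t (r + p) k = active t r k.
Proof.
rewrite /active vertex_per//; congr [&& _, _ & _]; rewrite /same_block.
by rewrite addnC modnMDl.
Qed.

Lemma relval_per w b j k f r : normalized b -> relval w b j k f (r + p)%N = relval w b j k f r.
Proof.
move=> bN; elim: f r => [|f IH] r /=; rewrite modnDr edge_per// vertex_per//.
by rewrite addnACp IH ycoef_perp.
Qed.

Lemma normalized_step (b b' : nat -> nat -> K) t F : normalized b ->
  (forall r k, b' r k = if active t r k then F r k else b r k) ->
  (forall r k, F (r + p)%N k = F r k) -> normalized b'.
Proof.
move=> [b0 bp bn] b'E Fp; split=> [r|r k|r k k0 rk].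
- by rewrite b'E active0.
- by rewrite !b'E active_per Fp bp.
- by rewrite b'E active_stage// (negPf rk) andbF bn.
Qed.

Lemma relval_step_norm w b t : normalized b -> normalized (relval_step w b t).
Proof.
move=> bN; apply: (normalized_step (F := fun r k => relval w b (block t) k n r) bN).
  by [].
by move=> r k; exact: relval_per.
Qed.

Lemma solution_norm w t : normalized (solution w t).
Proof.
elim: t => [|t IH] /=; first by split=> // r [].
apply: (normalized_step (F := fun r k => relval w (solution w t) (block t) k n r
   + root_value w (solution w t) t) IH) => // r k.
by rewrite relval_per.
Qed.

Lemma solution_late w t r k : (0 < k)%N -> (t <= stage r k)%N ->
  solution w t r k = 0.
Proof.
move=> k0; elim: t => [|t IH] tr /=; first by rewrite gtn_eqF.
by rewrite /step active_stage// gtn_eqF// IH// ltnW.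
Qed.

Lemma solution_stable w t t' r k : (0 < k)%N -> (stage r k < t)%N -> (t <= t')%N ->
  solution w t' r k = solution w t r k.
Proof.
move=> k0 rt; elim: t' => [|t' IH]; first by rewrite leqn0 => /eqP->.
rewrite leq_eqVlt => /orP[/eqP->//|tt'].
by rewrite /= /step active_stage// ltn_eqF ?IH//; exact: leq_trans rt _.
Qed.

Let reach' := reach n_gt0 d_gt0 m_gt0 mn_coprime.
Let edge_sourceE := edge_source n_gt0 d_gt0 gen_inv.
Let edge_targetE := edge_target n_gt0 d_gt0 gen_inv.
Let root_blockE : forall j k, same_block (root j k) j.
Proof. by move=> j k; apply: root_block. Qed.
Let root_edgeE := root_edge n_gt0 d_gt0 gen_per gen_inv m_gt0 mn_coprime.
Let vertex_depthE := vertex_depth n_gt0 d_gt0 gen_per m_gt0 mn_coprime.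
Let root_vertexE := root_vertex m n_gt0 d_gt0 gen_per.

Lemma modp_root j k : (root j k %% p = root j k)%N.
Proof. by rewrite modn_small// root_lt. Qed.

Lemma to_root r j k : same_block r j ->
  exists2 i, (i < n)%N & ((r + i * q) %% p = root j k)%N.
Proof.
move=> rj; have rr : same_block r (root j k).
  by apply: same_block_trans rj _; rewrite same_block_sym root_blockE.
by have [i ni iE] := reach' rr; exists i; rewrite // iE modp_root.
Qed.

Lemma relval_root w b j k f r : (r %% p)%N = root j k -> relval w b j k f r = 0.
Proof. by move=> rr; case: f => [|f] /=; rewrite rr eqxx. Qed.

(** Fuel beyond the distance to the root is never used. *)
Lemma relval_fuel w b j k f f' i r : ((r + i * q) %% p = root j k)%N ->
  (i <= f)%N -> (i <= f')%N -> relval w b j k f r = relval w b j k f' r.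
Proof.
elim: i f f' r => [|i IH] f f' r.
  by rewrite addn0 => rr _ _; rewrite !relval_root.
move=> E; case: f => // f; case: f' => // f'; rewrite !ltnS => fi fi' /=.
case: ifP => // _; case: ifP => // _; congr (_ - _); apply: IH => //.
by rewrite -addnA -mulSn.
Qed.

Lemma relvalE w b j k r : same_block r j -> (r %% p)%N != root j k -> edge r k ->
  relval w b j k n r = relval w b j k n (r + q)%N - ycoef b r k.
Proof.
move=> rj rr rk; have [[|i] ni iE] := to_root k rj.
  by move/eqP: rr; rewrite -iE addn0.
have iE' : ((r + q + i * q) %% p = root j k)%N by rewrite -addnA -mulSn.
rewrite (@relval_fuel _ _ _ _ n n.-1 i (r + q)%N)//; [|lia|lia].
have -> : relval w b j k n r = relval w b j k n.-1.+1 r by rewrite prednK.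
by rewrite /= (negPf rr) rk.
Qed.

Lemma relval_free w b j k f r : (r %% p)%N != root j k -> ~~ edge r k -> vertex r k ->
  relval w b j k f r = w (r %% p)%N k.
Proof. by case: f => [|f] /= /negPf-> /negPf-> ->. Qed.

(** The recursion determines the differences, by induction on the distance to
    the root. *)
Lemma relval_unique w b j k (g : nat -> K) :
  (forall r, same_block r j -> (r %% p)%N = root j k -> g r = 0) ->
  (forall r, same_block r j -> (r %% p)%N != root j k -> edge r k ->
     g r = g (r + q)%N - ycoef b r k) ->
  (forall r, same_block r j -> (r %% p)%N != root j k -> vertex r k ->
     ~~ edge r k -> g r = w (r %% p)%N k) ->
  forall r, same_block r j -> vertex r k -> g r = relval w b j k n r.
Proof.
move=> g0 ge gf.
suff H f : forall i r, same_block r j -> (i <= f)%N ->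
    ((r + i * q) %% p = root j k)%N -> vertex r k -> g r = relval w b j k f r.
  by move=> r rj; have [i /ltnW iN iE] := to_root k rj; exact: H iN iE.
elim: f => [|f IH] i r rj iN iE rk /=; last first.
  have [rr|rr] := eqVneq (r %% p)%N (root j k); first by rewrite g0.
  case: ifP => re; last first.
    by rewrite rk gf// re.
  rewrite ge//; congr (_ - _).
  case: i iN iE => [|i] iN iE; first by rewrite -iE addn0 eqxx in rr.
  apply: (IH i) => //; last exact: edge_targetE.
    exact: same_block_trans (same_block_addq _ _ _) rj.
  by rewrite -addnA -mulSn.
move: iN iE; rewrite leqn0 => /eqP->; rewrite addn0 => rr.
by rewrite g0// rr eqxx.
Qed.

(** Translation by q permutes a block. *)
Lemma sum_block_tele (X : nat -> K) j : (forall r, X (r + p)%N = X r) ->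
  \sum_(r < p | same_block r.+1 j) (X r - X (r + q)%N) = 0.
Proof.
move=> Xp; pose F r := if same_block r.+1 j then X r else 0.
have -> : \sum_(r < p | same_block r.+1 j) (X r - X (r + q)%N) =
          \sum_(r < p) F r - \sum_(r < p) F (r + q)%N.
  rewrite -sumrB [LHS]big_mkcond; apply: eq_bigr => r _ /=; rewrite /F.
  by rewrite same_blockSD; case: ifP => _; rewrite ?subrr.
by rewrite sum_shift ?subrr// => r; rewrite /F Xp same_blockSD.
Qed.

(** Since ycoef c r 1 = lam 1 + c r 1 - c (r + q) 1, the sum telescopes. By
    linked_next the terms removed by the vertex condition vanish. *)
Lemma sum_ycoef1 c j k : normalized c -> linked j k ->
  (forall r, same_block r.+1 j -> edge r 1 -> ycoef c r 1 = 0) ->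
  \sum_(r < p | same_block r.+1 j)
     ycoef c r 1 * (vertex (r + q + 1) k)%:R = n%:R * lam 1%N.
Proof.
move=> [c0 cp cn] lk h0.
rewrite (eq_bigr (fun r : 'I_p => lam 1%N + (c r 1%N - c (r + q)%N 1%N))).
  rewrite big_split /= (sum_block_tele (X := c^~ 1%N))// addr0.
  rewrite sumr_const mulr_natl; congr (_ *+ _).
  rewrite -sum1_card -[RHS](sum_modn_eq n (j + d.-1) d_gt0); apply: eq_bigl => r.
  rewrite unfold_in; change (same_block r.+1 j = (r == j + d.-1 %[mod d])).
  rewrite /same_block -(eqn_modDr d.-1).
  by rewrite (_ : r.+1 + d.-1 = r + d)%N ?modnDr//; lia.
move=> r rj; have -> : lam 1%N + (c r 1%N - c (r + q)%N 1%N) = ycoef c r 1.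
  rewrite ycoefE !big_ord_recl !big_ord0 /= !subn0 addn0 ycoefE.
  by rewrite !big_ord_recl !big_ord0 /= !lam0 !c0; ring.
have [re|rne] := boolP (edge r 1); first by rewrite h0// mul0r.
by rewrite (linked_next n_gt0 d_gt0 gen_per lk rj rne) mulr1.
Qed.

Section BlockStep.
Variables (w c : nat -> nat -> K) (t : nat).
Let b := solution w t.
Let k := level t.
Let j := block t.
Hypothesis c_norm : normalized c.
Hypothesis c_prev : forall t', (t' < t)%N -> block_eqs w c t'.
Hypothesis c_agree : forall r i, (0 < i)%N -> (stage r i < t)%N -> c r i = b r i.

Let b_norm : normalized b. Proof. exact: solution_norm. Qed.
Let k_gt0 : (0 < k)%N. Proof. by []. Qed.

Let agree_low r i : (i < k)%N -> c r i = b r i.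
Proof.
have [[c0 _ _] [b0 _ _]] := (c_norm, b_norm).
case: i => [|i] ik; first by rewrite c0 b0.
by apply: c_agree => //; apply: stage_level.
Qed.

Let b_block r : same_block r j -> b r k = 0.
Proof.
move=> rj; apply: solution_late => //.
by have /eqP-> : stage r k == t by rewrite stageE// eqxx.
Qed.

Let ycoef_block r : same_block r j ->
  ycoef c r k = ycoef b r k + (c r k - c (r + q)%N k).
Proof.
have [[c0 _ _] [b0 _ _]] := (c_norm, b_norm).
move=> rj; rewrite -[LHS](subrK (ycoef b r k)) addrC; congr (_ + _).
rewrite ycoef_top// ?(b_block rj) ?(@b_block (r + q)%N)//; first by rewrite !subr0.
exact: same_block_trans (same_block_addq _ _ _) rj.
Qed.

(** The unknowns of depth k.+1 cancel in the sum over a block, and those of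
    depth k in this block enter through ycoef_next, with coefficients whose sum
    is given by sum_ycoef1. *)
Let ycoef_linked y : linked j k ->
  (forall s, same_block s j -> vertex s k -> c s k = relval w b j k n s + y) ->
  \sum_(r < p | same_block r.+1 j) ycoef c r k.+1 =
  \sum_(r < p | same_block r.+1 j) ycoef (relval_step w b t) r k.+1
    - y * (n%:R * lam 1%N).
Proof.
move=> lk cE; have [c0 cp cn] := c_norm; have [b0 bp bn] := b_norm.
set b1 := relval_step w b t; have b1_norm : normalized b1 by exact: relval_step_norm.
have [b10 b1p b1n] := b1_norm.
have prev r : same_block r.+1 j -> (stage r k < t)%N.
  by move=> rj; rewrite -(stage_prev lk rj).
have same_b1 r i : (0 < i)%N -> stage r i != t -> b1 r i = b r i.
  by move=> i0 /negPf rt; rewrite /b1 /relval_step active_stage// rt.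
have low s i : (i < k)%N -> c s i = b1 s i.
  move=> ik; rewrite agree_low//; case: i ik => [|i] ik; first by rewrite b10 b0.
  by rewrite same_b1// ltn_eqF// stage_level.
have here r : same_block r.+1 j -> c r k = b1 r k.
  by move=> rj; rewrite same_b1// ?ltn_eqF ?prev// c_agree// prev.
have qj r : same_block r.+1 j -> same_block (r + q).+1 j.
  by rewrite same_blockSD.
have next r : same_block r.+1 j -> same_block (r + q + 1) j by rewrite addn1; exact: qj.
have cb1 s : same_block s j -> c s k - b1 s k = y * (vertex s k)%:R.
  move=> sj; have [sk|sk] := boolP (vertex s k); last first.
    by rewrite cn// b1n// subrr mulr0.
  rewrite mulr1 cE// /b1 /relval_step active_stage// sk stageE// eqxx sj /=.
  by rewrite addrC addKr.
rewrite -(@sum_ycoef1 c j k c_norm lk); last first.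
  move=> r rj re.
  have r1t : (stage r 1 < t)%N.
    have [k1|k1] := eqVneq k 1%N; first by rewrite -k1 prev.
    by apply: stage_level => //; rewrite ltn_neqAle eq_sym k1.
  have := stageE r (stage r 1) (ltnSn 0); rewrite eqxx => /esym/andP[/eqP l1 rb].
  have [E1 _ _ _] := c_prev r1t; rewrite l1; apply: E1 => //; last by rewrite -l1.
  apply: contraTneq re => rr; rewrite -(per_modn (edge_per m gen_per 1)) rr -l1.
  apply/negP => /root_edgeE; apply/negP; exact: full1.
rewrite mulr_sumr -sumrB.
pose X r := c r k.+1 - b1 r k.+1.
have tele : \sum_(r < p | same_block r.+1 j) (X r - X (r + q)%N) = 0.
  by apply: sum_block_tele => r; rewrite /X cp b1p.
rewrite -[RHS]addr0 -[X in _ = _ + X]tele -big_split /=; apply: eq_bigr => r rj; rewrite /X.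
apply: (@addIr _ (- ycoef b1 r k.+1)).
have -> := @ycoef_next K q lam lam0 c b1 r k k_gt0 c0 b10 low (here _ rj) (here _ (qj _ rj)).
by rewrite cb1 ?next//; ring.
Qed.

(** Given the earlier stages, the equations of stage t are a recursion along the
    edges for the differences to the root, and then one linear equation with
    nonzero coefficient for the value at the root. *)
Lemma block_stepP :
  (forall r i, (0 < i)%N -> stage r i = t -> c r i = solution w t.+1 r i) <->
  block_eqs w c t.
Proof.
have [c0 cp cn] := c_norm; set rho := root j k.
have step_vertex r : same_block r j -> vertex r k ->
    solution w t.+1 r k = relval w b j k n r + root_value w b t.
  by move=> rj rk; rewrite /= /step active_stage// rk stageE// eqxx rj.
have nextj r : same_block r j -> same_block (r + q) j.
  exact: same_block_trans (same_block_addq _ _ _).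
have rhoj : same_block rho j by exact: root_blockE.
have relval_rho : relval w b j k n rho = 0 by apply: relval_root; exact: modp_root.
split=> [cE|].
  have cE' s : same_block s j -> vertex s k -> c s k = relval w b j k n s + root_value w b t.
    move=> sj sk; rewrite -step_vertex// cE//; apply/eqP; by rewrite stageE// eqxx.
  have crho : vertex rho k -> c rho k = root_value w b t.
    by move=> rk; rewrite cE'// relval_rho add0r.
  split=> [r rj rr re|lk|r rj rr rk re|nl rk].
  - rewrite ycoef_block// !cE' ?nextj//; [|exact: edge_targetE|exact: edge_sourceE].
    by rewrite (relvalE _ _ rj rr re); ring.
  - rewrite (ycoef_linked lk cE') /root_value -/k -/j lk.
    by rewrite divfK// subrr.
  - have rhok : vertex rho k by exact: root_vertexE rj rk.
    by rewrite crho// cE'// relval_free// addrK.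
  - by rewrite crho// /root_value -/k -/j (negPf nl) rk.
move=> [E1 E2 E3 E4] r i i0 rt.
have /andP[/eqP-> rj] : (i == k) && same_block r j by rewrite -stageE// rt.
have [rk|rk] := boolP (vertex r k); last first.
  have [_ _ sn] := solution_norm w t.+1.
  by rewrite cn// sn.
have rhok : vertex rho k by exact: root_vertexE rj rk.
have cE s : same_block s j -> vertex s k -> c s k = relval w b j k n s + c rho k.
  move=> sj sk; apply/eqP; rewrite -subr_eq; apply/eqP.
  apply: (relval_unique (g := fun s => c s k - c rho k)) => //.
  - move=> v vj vr; by rewrite -(per_modn (cp^~ k)) vr subrr.
  - move=> v vj vr ve; have := E1 v vj vr ve; rewrite ycoef_block// => e.
    by apply/eqP; rewrite -subr_eq0 -[X in _ == X]e; apply/eqP; ring.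
rewrite cE// step_vertex//; congr (_ + _).
rewrite /root_value -/k -/j; case: ifP => lk; last by rewrite rhok E4// lk.
apply: (mulIf nlam1); rewrite divfK//; apply/eqP.
by rewrite eq_sym -subr_eq0 -(ycoef_linked lk cE) E2.
Qed.

End BlockStep.

Definition relations (c : nat -> nat -> K) :=
  forall r k, (0 < k)%N -> edge r k -> ycoef c r k = 0.

(** The coordinate on the solutions attached to a free unknown. The difference
    to the root is used since the value at a linked root is not a parameter,
    whereas translating a whole block changes no difference. *)
Definition free_coord (c : nat -> nat -> K) r k :=
  if (r %% p)%N == root r k then c r k else c r k - c (root r k) k.

Lemma block_eqsP w c T : normalized c ->
  (forall t, (t < T)%N -> block_eqs w c t) <->
  (forall r i, (0 < i)%N -> (stage r i < T)%N -> c r i = solution w T r i).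
Proof.
move=> cN; elim: T => [|T IH]; first by split.
split=> [E r i i0|cE].
  have cT : forall t, (t < T)%N -> block_eqs w c t by move=> t tT; exact/E/ltnW.
  move/IH: (cT) => cA; rewrite ltnS leq_eqVlt => /orP[/eqP rT|rT].
    have [_ H] := block_stepP cN cT cA.
    by apply: H => //; exact: E.
  by rewrite (solution_stable w i0 rT (leqnSn T)) cA.
have cA r i : (0 < i)%N -> (stage r i < T)%N -> c r i = solution w T r i.
  by move=> i0 rT; rewrite cE//; [exact: solution_stable|exact: ltnW].
move/IH: (cA) => cT t; rewrite ltnS leq_eqVlt => /orP[/eqP->|/cT//].
by apply/(block_stepP cN cT cA) => r i i0 rT; rewrite cE// rT.
Qed.

(** The only relations that are not block equations are those at the roots of
    full blocks. The sum of the relations of a full block is zero by the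
    equation that links the next block one depth lower, and all its other terms
    vanish. *)
Lemma solutionP w c : normalized c ->
  (relations c /\ forall r k, (r < p)%N -> free r k -> free_coord c r k = w r k) <->
  (forall r k, c r k = solution w (depth * d) r k).
Proof.
move=> cN; have [c0 cp cn] := cN; set T := (depth * d)%N.
have [s0 sp sn] := solution_norm w T.
have stageT r k : (0 < k)%N -> (k <= depth)%N -> (stage r k < T)%N.
  move=> k0 kd; apply: leq_trans (stage_lt r k0) _.
  by rewrite leq_mul2r kd orbT.
apply: (@iff_trans _ (forall t, (t < T)%N -> block_eqs w c t)); last first.
  rewrite block_eqsP//; split=> [E r [|k]|E r k _ _//].
    by rewrite c0 s0.
  have [rk|rk] := boolP (vertex r k.+1); last by rewrite cn// sn.
  by rewrite E// stageT// (vertex_depthE rk).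
split=> [[S F] t tT|E].
  set k := level t; set j := block t.
  split=> [r rj rr re|/(linkedP m n_gt0 d_gt0 gen_per) lk|r rj rr rk re|nl rk].
  - exact: S.
  - by apply: big1 => r rj; apply: S => //; exact: lk.
  - have rjm : same_block (r %% p) j by exact: same_block_trans (same_block_modp _ _ _) rj.
    have := F (r %% p)%N k; rewrite ltn_pmod ?period_gt0// => /(_ isT).
    rewrite /free /free_coord (root_same m n gen _ rjm) modn_mod (negPf rr).
    rewrite (per_modn (vertex_per gen_per k)) (per_modn (edge_per m gen_per k)) rk re.
    by rewrite (per_modn (cp^~ k)) => ->.
  - have rhoj := root_blockE j k.
    have := F (root j k) k; rewrite root_lt// => /(_ isT).
    rewrite /free /free_coord (root_same m n gen _ rhoj) modp_root eqxx rk.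
    by rewrite (@linked_same m n d gen n_gt0 d_gt0 gen_per _ _ _ rhoj) nl => ->.
have at_stage r k : (0 < k)%N -> vertex r k ->
    exists2 t, (t < T)%N & k = level t /\ same_block r (block t).
  move=> k0 rk; exists (stage r k); first by rewrite stageT// (vertex_depthE rk).
  by have := stageE r (stage r k) k0; rewrite eqxx => /esym/andP[/eqP].
split=> [r k k0 re|r k rp /andP[rk]]; last first.
  have k0 : (0 < k)%N by case: k rk => //; rewrite (negPf (vertex0 gen r)).
  have [t tT [kE rj]] := at_stage r k k0 rk.
  have [_ _ E3 E4] := E _ tT; rewrite /free_coord (modn_small rp) (root_same m n gen _ rj).
  case: eqVneq => [rr nl|rr re]; last first.
    rewrite kE (E3 r) ?(modn_small rp) -?kE//.
  rewrite rr kE E4// -?kE -?rr//.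
  by rewrite -(@linked_same m n d gen n_gt0 d_gt0 gen_per _ _ _ rj).
have rk := edge_sourceE re.
have [t tT [kE rj]] := at_stage r k k0 rk; have [E1 _ _ _] := E _ tT.
have [rr|rr] := eqVneq (r %% p)%N (root (block t) k); last first.
  by rewrite kE; apply: E1; rewrite -?kE.
(* The root of a full block: use the equation that links the next block. *)
have fk : full (block t) k.
  by apply: root_edgeE; rewrite -rr (per_modn (edge_per m gen_per k)).
case: k k0 re rk kE rr fk => // -[|k] _ re rk kE rr fk.
  by case/negP: (full1 n_gt0 d_gt0 gen_per gen_adm (block t)).
have rS : same_block r.+1 (block t).+1.
  by rewrite -addn1 -[(block t).+1]addn1 same_blockD.
have lk : linked r.+1 k.+1.
  rewrite (@linked_same m n d gen n_gt0 d_gt0 gen_per _ _ _ rS).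
  by rewrite (linkedS m n_gt0 d_gt0 gen_per).
have s1 : (stage r.+1 k.+1 < T)%N.
  by rewrite stageT//; have := vertex_depthE rk; lia.
have [_ E2 _ _] := E _ s1.
have := stageE r.+1 (stage r.+1 k.+1) (ltn0Sn k); rewrite eqxx.
move=> /esym/andP[/eqP lE]; rewrite -lE in E2; move=> rb'.
have := E2; rewrite -(@linked_same m n d gen n_gt0 d_gt0 gen_per _ _ _ rb').
move=> /(_ lk).
rewrite (bigD1 (Ordinal (ltn_pmod r (period_gt0 n_gt0 d_gt0))))/=; last first.
  rewrite -addn1; apply: same_block_trans rb'; rewrite -[r.+1]addn1 same_blockD.
  exact: same_block_modp.
rewrite (per_modn (ycoef_perp cN k.+2)) big1 ?addr0// => s /andP[sb /eqP sr].
have sj : same_block s (block t).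
  rewrite -(same_blockD _ _ _ 1) !addn1; apply: same_block_trans sb _.
  by apply: same_block_trans rS; rewrite same_block_sym.
rewrite kE; apply: E1; rewrite -?kE//.
  rewrite modn_small//; apply/eqP => sE; apply: sr; apply: val_inj.
  by rewrite /= rr.
by move/(fullP m n_gt0 d_gt0 gen_per): fk; apply.
Qed.

Section Polynomiality.
Variables (U : Type) (Pol : (U -> K) -> Prop).
Hypothesis Pol_ext : forall f g, f =1 g -> Pol f -> Pol g.
Hypothesis Pol_const : forall x : K, Pol (fun=> x).
Hypothesis Pol_add : forall f g, Pol f -> Pol g -> Pol (fun u => f u + g u).
Hypothesis Pol_mul : forall f g, Pol f -> Pol g -> Pol (fun u => f u * g u).

Lemma Pol_sum (I : Type) (s : seq I) (P : pred I) (f : I -> U -> K) :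
  (forall i, P i -> Pol (f i)) -> Pol (fun u => \sum_(i <- s | P i) f i u).
Proof.
move=> fP; elim: s => [|i s IH].
  by apply: (Pol_ext (f := fun=> 0)) => // u; rewrite big_nil.
have [Pi|nPi] := boolP (P i).
  apply: Pol_ext (Pol_add (fP _ Pi) IH) => u; by rewrite big_cons Pi.
by apply: Pol_ext IH => u; rewrite big_cons (negPf nPi).
Qed.

Lemma Pol_sub f g : Pol f -> Pol g -> Pol (fun u => f u - g u).
Proof.
move=> Pf Pg; apply: Pol_ext (Pol_add Pf (Pol_mul (Pol_const (-1)) Pg)) => u.
by rewrite mulN1r.
Qed.

Lemma Pol_ycoef (c : U -> nat -> nat -> K) r k :
  (forall r k, Pol (fun u => c u r k)) -> Pol (fun u => ycoef (c u) r k).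
Proof.
move=> cP; elim/ltn_ind: k => k IH.
apply: (@Pol_ext (fun u => \sum_(i < k.+1) lam i * c u r (k - i)%N -
  \sum_(i < k) ycoef (c u) r i * c u (r + q + i)%N (k - i)%N)).
  by move=> u; rewrite -ycoefE.
by apply: Pol_sub; apply: Pol_sum => i _; apply: Pol_mul => //; exact: IH.
Qed.

Lemma Pol_relval (w b : U -> nat -> nat -> K) j k f r :
  (forall r k, Pol (fun u => w u r k)) -> (forall r k, Pol (fun u => b u r k)) ->
  Pol (fun u => relval (w u) (b u) j k f r).
Proof.
move=> wP bP; elim: f r => [|f IH] r /=.
  by case: (_ == _) => //; case: (edge r k) => //; case: (vertex r k) => /=.
case: (_ == _) => //; case: (edge r k) => /=; last by case: (vertex r k) => /=.
by apply: Pol_sub; [exact: IH|exact: (Pol_ycoef (c := b))].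
Qed.

(** Every step of the construction is polynomial: the only division is by n *
    lam 1. *)
Lemma Pol_solution (w : U -> nat -> nat -> K) t r k :
  (forall r k, Pol (fun u => w u r k)) -> Pol (fun u => solution (w u) t r k).
Proof.
move=> wP; elim: t r k => [|t IH] r k //=; rewrite /step.
case: (active t r k) => //=; apply: Pol_add.
  exact: (Pol_relval (b := fun u => solution (w u) t)).
rewrite /root_value; case: (linked _ _) => /=; last by case: (vertex _ _) => /=.
apply: Pol_mul => //; apply: Pol_sum => s _.
apply: (Pol_ycoef (c := fun u => relval_step (w u) (solution (w u) t) t)) => {}r {}k.
rewrite /relval_step; case: (active t r k) => //=.
exact: (Pol_relval (b := fun u => solution (w u) t)).
Qed.

End Polynomiality.

End Solution.

Local Open Scope classical_set_scope.

(** * Products of Laurent series *)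

Section LaurentTheory.
Variable K : fieldType.
Implicit Types (f g h : int -> K) (M : set (int -> K)).

Lemma fsum_seq (T : choiceType) (s : seq T) (F : T -> K) : uniq s ->
  (forall i, i \notin s -> F i = 0) ->
  \sum_(i \in [set: T]) F i = \sum_(i <- s) F i.
Proof.
move=> us F0; rewrite (fsbigE s)// => [|i _]; last exact: F0.
by apply: eq_bigl => i; rewrite in_setT.
Qed.

Lemma tpow_le A B f : (A <= B) -> tpow B f -> tpow A f.
Proof. by move=> AB fB k kA; apply: fB; exact: lt_le_trans AB. Qed.

(** The bounds A and n may be chosen generously, which makes sums for different
    products comparable. *)
Lemma lmulE A B n f g k : tpow A f -> tpow B g -> k < A + B + n%:Z ->
  lmul f g k = \sum_(i < n) f (A + i%:Z) * g (k - A - i%:Z).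
Proof.
move=> fA gB kn; rewrite /lmul (@fsum_seq _ [seq A + i%:Z | i <- iota 0 n]).
- rewrite big_map -{1}[n]subn0 -/(index_iota 0 n) big_mkord.
  by apply: eq_bigr => i _; rewrite opprD addrA.
- by rewrite map_inj_uniq ?iota_uniq// => i j /addrI [].
- move=> i; have [iA _|iA] := ltP i A; first by rewrite fA// mul0r.
  have [ki _|ki] := ltP (k - i) B; first by rewrite gB// mulr0.
  case/mapP; exists `|i - A|%N; last by lia.
  by rewrite mem_iota; lia.
Qed.

Lemma tpow_lmul A B f g : tpow A f -> tpow B g -> tpow (A + B) (lmul f g).
Proof.
by move=> fA gB k kAB; rewrite (@lmulE A B 0%N) ?big_ord0// addr0.
Qed.

Lemma lmulC f g : lmul f g = lmul g f.
Proof.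
apply/funext => k; rewrite /lmul.
rewrite (@reindex_fsbigT _ _ _ _ _ (fun i => k - i))//=.
  by apply: eq_fsbigr => i _; rewrite subKr mulrC.
by exists (fun i => k - i) => i; rewrite subKr.
Qed.

Lemma lmulA f g h : laurent f -> laurent g -> laurent h ->
  lmul f (lmul g h) = lmul (lmul f g) h.
Proof.
move=> [A fA] [B gB] [C hC]; apply/funext => k.
pose n := (absz (k - A - B - C)%R).+1.
rewrite (@lmulE A (B + C) n)//; [|exact: tpow_lmul|by rewrite /n; lia].
rewrite (@lmulE (A + B) C n)//; [|exact: tpow_lmul|by rewrite /n; lia].
under eq_bigr => i _.
  (* The bound B - i aligns the inner sums with those of the right-hand side. *)
  have gBi : tpow (B - i%:Z) g by apply: tpow_le gB; rewrite gerBl.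
  have ki : k - A - i%:Z < B - i%:Z + C + n%:Z.
    have : k - A - B - C < n%:Z by rewrite /n; lia.
    lia.
  rewrite (lmulE gBi hC ki); over.
under [RHS]eq_bigr => s _.
  rewrite (@lmulE A B n)//; last by rewrite ltrD2l ltz_nat.
  rewrite mulr_suml; over.
rewrite [RHS]exchange_big; apply: eq_bigr => i _ /=; rewrite mulr_sumr.
apply: eq_bigr => s _; rewrite mulrA; congr (_ * g _ * h _); lia.
Qed.

Lemma tpow_monom a : tpow a (@monom K a).
Proof. by move=> k ka; rewrite /monom lt_eqF. Qed.

Lemma lmul_monom a f k : lmul (@monom K a) f k = f (k - a).
Proof.
rewrite /lmul (@fsum_seq _ [:: a])//; last first.
  by move=> i; rewrite inE /monom => /negPf->; rewrite mul0r.
by rewrite big_seq1 /monom eqxx mul1r.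
Qed.

Lemma lmul1 f : lmul (@monom K 0) f = f.
Proof. by apply/funext => k; rewrite lmul_monom subr0. Qed.

Lemma lmulDr f g h (b : K) : laurent f -> laurent g -> laurent h ->
  lmul f (fun k => b * g k + h k) = fun k => b * lmul f g k + lmul f h k.
Proof.
move=> [A fA] [B gB] [C hC]; apply/funext => k.
pose D := Order.min B C; have [DB DC] : D <= B /\ D <= C by rewrite /D; lia.
have gD := tpow_le DB gB; have hD := tpow_le DC hC.
have bD : tpow D (fun k => b * g k + h k).
  by move=> i iD; rewrite gD// hD// mulr0 addr0.
pose n := (absz (k - A - D)%R).+1; have kn : k < A + D + n%:Z by rewrite /n; lia.
rewrite !(@lmulE A D n)// mulr_sumr -big_split; apply: eq_bigr => i _ /=.
by rewrite mulrDr mulrCA.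
Qed.

(** The first two coefficients of a product. *)
Lemma lmul_lead A B f g : tpow A f -> tpow B g -> lmul f g (A + B) = f A * g B.
Proof.
move=> fA gB; rewrite (@lmulE A B 1%N)// ?ltrDl// big_ord1 addr0 subr0.
by congr (_ * g _); lia.
Qed.

Lemma lmul_next A B f g : tpow A f -> tpow B g ->
  lmul f g (A + B + 1) = f A * g (B + 1) + f (A + 1) * g B.
Proof.
move=> fA gB; rewrite (@lmulE A B 2%N)//; last by lia.
rewrite big_ord_recl big_ord1 /= addr0 subr0 /bump /=.
by congr (_ * g _ + _ * g _); lia.
Qed.

Lemma laurent_lmul f g : laurent f -> laurent g -> laurent (lmul f g).
Proof. by move=> [A fA] [B gB]; exists (A + B); exact: tpow_lmul. Qed.

Lemma laurent_monom a : laurent (@monom K a).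
Proof. by exists a; exact: tpow_monom. Qed.

Lemma lexpS f i : lexp f i.+1 = lmul f (lexp f i). Proof. by []. Qed.

Lemma tpow_lexp (a : int) f i : tpow a f -> tpow (a * i%:Z) (lexp f i).
Proof.
move=> fa; elim: i => [|i IH]; first by rewrite mulr0; exact: tpow_monom.
rewrite lexpS (_ : a * i.+1 = a + a * i) ?intS; last by ring.
exact: tpow_lmul.
Qed.

Lemma lexp_monom (a : int) i : lexp (@monom K a) i = @monom K (a * i%:Z).
Proof.
elim: i => [|i IH]; first by rewrite mulr0.
have -> : a * i.+1%:Z = a + a * i%:Z by rewrite intS; ring.
apply/funext => k; rewrite lexpS IH lmul_monom /monom.
by rewrite subr_eq addrC.
Qed.

Lemma lexp_lead (a : int) f i : tpow a f -> f a = 1 ->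
  lexp f i (a * i%:Z) = 1 /\ lexp f i (a * i%:Z + 1) = f (a + 1) *+ i.
Proof.
move=> fa f1; elim: i => [|i [IH1 IH2]].
  by rewrite mulr0 /lexp /= /monom eqxx.
have E : a * i.+1 = a + a * i by rewrite intS; ring.
rewrite lexpS E; split; first by rewrite lmul_lead ?f1 ?IH1 ?mulr1//; exact: tpow_lexp.
rewrite lmul_next//; last exact: tpow_lexp.
by rewrite f1 IH1 IH2 mul1r mulr1 mulrSr addrC addrC.
Qed.

End LaurentTheory.

Section Subspace.
Variables (K : fieldType) (M : set (int -> K)).
Hypothesis M_sub : subspace M.
Implicit Types f g : int -> K.

Let M0 : M (fun=> 0). Proof. by case: M_sub. Qed.

Lemma subspace_scale b f : M f -> M (fun k => b * f k).
Proof.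
move=> Mf; have [_ H] := M_sub; have := H b _ _ Mf M0.
by congr M; apply/funext => k; rewrite addr0.
Qed.

Lemma subspace_add f g : M f -> M g -> M (fun k => f k + g k).
Proof.
move=> Mf Mg; have [_ H] := M_sub; have := H 1 _ _ Mf Mg.
by congr M; apply/funext => k; rewrite mul1r.
Qed.

Lemma subspace_sub f g : M f -> M g -> M (fun k => f k - g k).
Proof.
move=> Mf Mg; have [_ H] := M_sub; have := H (-1) _ _ Mg Mf.
by congr M; apply/funext => k; rewrite mulN1r addrC.
Qed.

Lemma subspace_sum (I : Type) (s : seq I) (P : pred I) (F : I -> int -> K) :
  (forall i, P i -> M (F i)) -> M (fun k => \sum_(i <- s | P i) F i k).
Proof.
move=> FM; elim: s => [|i s IH].
  by rewrite (_ : (fun _ => _) = fun=> 0)//; apply/funext => k; rewrite big_nil.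
have [Pi|nPi] := boolP (P i).
  have := subspace_add (FM _ Pi) IH; congr M; apply/funext => k.
  by rewrite big_cons Pi.
by move: IH; congr M; apply/funext => k; rewrite big_cons (negPf nPi).
Qed.

End Subspace.

(** * The ring of the curve *)

Section CurveRing.
Variables (K : fieldType) (p q : nat) (x y : int -> K).
Hypothesis period_gt0 : (0 < p)%N.
Hypothesis q_gt0 : (0 < q)%N.
Hypothesis xE : x = @monom K p%:Z.
Hypothesis y_low : tpow q%:Z y.
Let O := curve_ring x y.

Definition mon i j := lmul (lexp x i) (lexp y j).

Let x_low : tpow p%:Z x. Proof. by rewrite xE; exact: tpow_monom. Qed.
Let x_laurent : laurent x. Proof. by exists p%:Z. Qed.
Let y_laurent : laurent y. Proof. by exists q%:Z. Qed.
Let xi_laurent i : laurent (lexp x i).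
Proof. by exists (p%:Z * i%:Z); exact: tpow_lexp. Qed.
Let yj_laurent j : laurent (lexp y j).
Proof. by exists (q%:Z * j%:Z); exact: tpow_lexp. Qed.

Lemma tpow_mon i j : tpow (i + j)%N%:Z (mon i j).
Proof.
apply: (@tpow_le _ _ (p%:Z * i%:Z + q%:Z * j%:Z)).
  by rewrite -!PoszM -PoszD lez_nat leq_add// leq_pmull.
by apply: tpow_lmul; exact: tpow_lexp.
Qed.

Lemma monE i j k : mon i j k = lexp y j (k - (p * i)%N%:Z).
Proof. by rewrite /mon xE lexp_monom -PoszM lmul_monom. Qed.

(** Only finitely many monomials contribute to a coefficient, as x^i y^j has
    order at least i + j. *)
Lemma curve_ring_sumE (c : nat -> nat -> K) (n : nat) k : k < n%:Z ->
  \sum_(s \in [set: nat * nat]) c s.1 s.2 * lmul (lexp x s.1) (lexp y s.2) k =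
  \sum_(i < n) \sum_(j < n) c i j * mon i j k.
Proof.
move=> kn; rewrite (@fsum_seq _ _ [seq (i, j) | i <- iota 0 n, j <- iota 0 n]).
- rewrite big_allpairs -{1}[n]subn0 -/(index_iota 0 n) big_mkord.
  by apply: eq_bigr => i _; rewrite -{1}[n]subn0 -/(index_iota 0 n) big_mkord.
- by rewrite allpairs_uniq ?iota_uniq// => -[i j] [i' j'].
move=> [i j] /= ij; rewrite -/(mon i j) tpow_mon ?mulr0//; apply: lt_le_trans kn _.
rewrite lez_nat leqNgt; apply: contra ij => ij.
by apply/allpairsP; exists (i, j); rewrite !mem_iota /=; split=> //; lia.
Qed.

Lemma curve_ringP f : O f <-> exists c : nat -> nat -> K, forall (n : nat) k, k < n%:Z ->
  f k = \sum_(i < n) \sum_(j < n) c i j * mon i j k.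
Proof.
split=> -[c cE]; exists c.
  by move=> n k kn; rewrite cE (curve_ring_sumE _ kn).
move=> k; rewrite (@curve_ring_sumE c (absz k).+1) ?(cE (absz k).+1)//; lia.
Qed.

Lemma curve_ring_tpow0 : O `<=` tpow 0.
Proof. by move=> f /curve_ringP[c cE] k k0; rewrite (cE 0%N)// big_ord0. Qed.

Lemma curve_ring_subspace : subspace O.
Proof.
split.
  apply/curve_ringP; exists (fun _ _ => 0) => n k _.
  by rewrite big1// => i _; rewrite big1// => j _; rewrite mul0r.
move=> b f g /curve_ringP[c cE] /curve_ringP[e eE]; apply/curve_ringP.
exists (fun i j => b * c i j + e i j) => n k kn.
rewrite (cE n)// (eE n)// mulr_sumr -big_split; apply: eq_bigr => i _ /=.
rewrite mulr_sumr -big_split; apply: eq_bigr => j _ /=.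
by rewrite mulrDl mulrA.
Qed.

Lemma lmul_curve_ring (c : nat -> nat -> K) g f (A : int) (n : nat) k :
  (forall (n : nat) k, k < n%:Z -> g k = \sum_(i < n) \sum_(j < n) c i j * mon i j k) ->
  tpow A f -> k < A + n%:Z ->
  lmul g f k = \sum_(i < n) \sum_(j < n) c i j * lmul (mon i j) f k.
Proof.
move=> cE fA kn; have g0 : tpow 0 g.
  by move=> l l0; rewrite (cE 0%N)// big_ord0.
rewrite (lmulE g0 fA (n := n)) ?add0r//.
under eq_bigr => s _.
  rewrite (cE n) ?add0r ?ltz_nat// mulr_suml.
  under eq_bigr => i _ do rewrite mulr_suml.
  over.
rewrite exchange_big; apply: eq_bigr => i _ /=.
rewrite exchange_big; apply: eq_bigr => j _ /=.
have m0 : tpow 0 (mon i j) by apply: tpow_le (@tpow_mon i j).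
rewrite (lmulE m0 fA (n := n)) ?add0r// mulr_sumr.
by apply: eq_bigr => s _; rewrite add0r mulrA.
Qed.

Lemma mulx_mon i j : lmul (mon i j) x = mon i.+1 j.
Proof. by rewrite /mon lmulC lmulA. Qed.

Lemma muly_mon i j : lmul (mon i j) y = mon i j.+1.
Proof. by rewrite /mon -lmulA// (lmulC _ y). Qed.

Lemma curve_ring_mulx f : O f -> O (lmul x f).
Proof.
move=> /curve_ringP[c cE]; apply/curve_ringP.
exists (fun i j => if i is i'.+1 then c i' j else 0) => n k kn.
rewrite lmulC (lmul_curve_ring cE x_low (n := n)); last by lia.
under eq_bigr => i _ do under eq_bigr => j _ do rewrite mulx_mon.
have -> : \sum_(i < n) \sum_(j < n) c i j * mon i.+1 j k =
  \sum_(i < n.+1) \sum_(j < n) (if i : nat is i'.+1 then c i' j else 0) * mon i j k.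
  rewrite big_ord_recl [X in _ = X + _]big1 ?add0r// => j _; by rewrite mul0r.
rewrite big_ord_recr /= [X in _ + X]big1 ?addr0//= => j _.
by rewrite tpow_mon ?mulr0//; lia.
Qed.

Lemma curve_ring_muly f : O f -> O (lmul y f).
Proof.
move=> /curve_ringP[c cE]; apply/curve_ringP.
exists (fun i j => if j is j'.+1 then c i j' else 0) => n k kn.
rewrite lmulC (lmul_curve_ring cE y_low (n := n)); last by lia.
under eq_bigr => i _ do under eq_bigr => j _ do rewrite muly_mon.
apply: eq_bigr => i _.
have -> : \sum_(j < n) c i j * mon i j.+1 k =
  \sum_(j < n.+1) (if j : nat is j'.+1 then c i j' else 0) * mon i j k.
  by rewrite big_ord_recl mul0r add0r.
by rewrite big_ord_recr /= [X in _ + X](_ : _ = 0) ?addr0// tpow_mon ?mulr0//; lia.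
Qed.

Lemma curve_ring_xseries P : (forall k, ~~ ((0 <= k) && (p %| absz k)%N) -> P k = 0) ->
  O P.
Proof.
move=> P0; apply/curve_ringP; exists (fun i j => P (p * i)%N%:Z *+ (j == 0%N)) => n k kn.
have -> : \sum_(i < n) \sum_(j < n) P (p * i)%N%:Z *+ (j == 0%N :> nat) * mon i j k =
  \sum_(i < n) P (p * i)%N%:Z * (k == (p * i)%N%:Z)%:R.
  apply: eq_bigr => i _; have n0 : (0 < n)%N by exact: leq_ltn_trans (ltn_ord i).
  rewrite (bigD1 (Ordinal n0))//= big1 ?addr0.
    by rewrite monE /lexp/= /monom subr_eq0.
  by move=> j /eqP j0; case: eqP => [e|_]; rewrite ?mul0r//; case: j0; apply: val_inj.
have [/andP[k0 /dvdnP[i iE]]|nk] := boolP ((0 <= k) && (p %| absz k)%N); last first.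
  rewrite P0// big1// => i _; case: eqP => [e|_]; rewrite ?mulr0//.
  by case/negP: nk; rewrite e /= dvdn_mulr.
have kE : k = (p * i)%N%:Z by rewrite mulnC -iE gez0_abs.
have ni : (i < n)%N.
  by move: kn; rewrite kE ltz_nat; apply: leq_ltn_trans; rewrite leq_pmull.
rewrite (bigD1 (Ordinal ni))//= -kE eqxx mulr1 big1 ?addr0// => j /eqP ji.
case: eqP => [|_]; rewrite ?mulr0// kE => -[] /eqP.
by rewrite eqn_pmul2l// => /eqP e; case: ji; apply: val_inj.
Qed.

Lemma curve_ring_x : O x.
Proof.
rewrite xE; apply: curve_ring_xseries => k; rewrite /monom; case: eqP => // -> /=.
by rewrite dvdnn.
Qed.

Lemma curve_ring_y : O y.
Proof.
rewrite -[y]lmul1 lmulC; apply: curve_ring_muly; apply: curve_ring_xseries => k.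
by rewrite /monom; case: eqP => // ->; rewrite dvdn0.
Qed.

(** Up to any given degree, the product with a series in x and y is the product
    with a polynomial in x and y; closedness does the rest. *)
Lemma curve_moduleP M : M `<=` @laurent K -> subspace M -> tclosed M ->
  (forall f, M f -> M (lmul x f)) -> (forall f, M f -> M (lmul y f)) ->
  curve_module x y M.
Proof.
move=> Ml Ms Mc Mx My; split=> // g f /curve_ringP[c cE] Mf.
have fl := Ml _ Mf; have [A fA] := fl.
have g0 : tpow 0 g by move=> l l0; rewrite (cE 0%N)// big_ord0.
have monM i j : M (lmul (mon i j) f).
  rewrite /mon -lmulA//; elim: i => [|i IH]; last by rewrite lexpS -lmulA//; [exact: Mx|exact: laurent_lmul].
  rewrite lmul1; elim: j => [|j IH]; first by rewrite lmul1.
  by rewrite lexpS -lmulA//; exact: My.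
apply: Mc; first by exists (0 + A); exact: tpow_lmul.
move=> N; pose n := (absz (N - A)%R).
exists (fun k => \sum_(i < n) \sum_(j < n) c i j * lmul (mon i j) f k).
  apply: (@subspace_sum K M Ms _ _ _
    (fun (i : 'I_n) k => \sum_(j < n) c i j * lmul (mon i j) f k)) => i _.
  apply: (@subspace_sum K M Ms _ _ _
    (fun (j : 'I_n) k => c i j * lmul (mon i j) f k)) => j _.
  exact: subspace_scale.
move=> k kN; rewrite (lmul_curve_ring cE fA (n := n)) ?subrr//.
by rewrite /n; lia.
Qed.

End CurveRing.

(** * The conductor *)

Section Conductor.
Variables (K : fieldType) (m n d : nat) (x y : int -> K).
Local Notation p := (n * d)%N.
Local Notation q := (m * d)%N.
Hypothesis n_gt0 : (0 < n)%N.
Hypothesis d_gt0 : (0 < d)%N.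
Hypothesis m_gt0 : (0 < m)%N.
Hypothesis xE : x = @monom K p%:Z.
Hypothesis y_low : tpow q%:Z y.
Hypothesis y_lead : y q%:Z = 1.
Hypothesis y_next : y (q + 1)%N%:Z *+ n != 0.
Let O := curve_ring x y.
Let period_gt0 : (0 < p)%N. Proof. by rewrite muln_gt0 n_gt0. Qed.
Let q_gt0 : (0 < q)%N. Proof. by rewrite muln_gt0 m_gt0. Qed.

Let a := (m * p).+1.

(** z = y^n - x^m; its order a is one more than the common order of y^n and x^m. *)
Let z : int -> K := fun k => (-1) * lexp x m k + lexp y n k.
Let lead := y (q + 1)%N%:Z *+ n.
Let x_laurent : laurent x. Proof. by rewrite xE; exact: laurent_monom. Qed.
Let y_laurent : laurent y. Proof. by exists q%:Z. Qed.

Let z_low : tpow a%:Z z.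
Proof.
move=> k; rewrite /a intS addrC => ka; rewrite /z xE lexp_monom /monom.
have E : (m * p = q * n)%N by ring.
have y1 := lexp_lead n y_low y_lead.
rewrite -!PoszM mulnC E.
have [lt|gt|->] := ltgtP k (q * n)%N%:Z; last by rewrite -PoszM in y1; rewrite y1.1 mulr1 addNr.
  by rewrite mulr0 add0r (tpow_lexp (i := n) y_low)// -PoszM.
by move: ka gt; rewrite E; lia.
Qed.

Let z_lead : z a%:Z = lead.
Proof.
have [_ y2] := lexp_lead n y_low y_lead.
have E : (m * p = q * n)%N by ring.
rewrite /z xE lexp_monom /monom /a E (_ : (q * n).+1%:Z = q%:Z * n%:Z + 1); last first.
  by rewrite intS -PoszM addrC.
have E' : p%:Z * m%:Z = q%:Z * n%:Z by rewrite -!PoszM -E mulnC.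
rewrite y2 E' (_ : (_ == _) = false) ?mulr0 ?add0r /lead ?PoszD//.
by apply/negP => /eqP; lia.
Qed.

Lemma lexp_leadX (K' : fieldType) (e : int) (f : int -> K') i :
  tpow e f -> lexp f i (e * i%:Z) = f e ^+ i.
Proof.
move=> fe; elim: i => [|i IH]; first by rewrite mulr0 /lexp /= /monom eqxx.
have -> : e * i.+1%:Z = e + e * i%:Z by rewrite intS; ring.
by rewrite lexpS lmul_lead ?IH ?exprS//; exact: tpow_lexp.
Qed.

Let curve_ring_lexp g i f : laurent g -> laurent f ->
  (forall f, laurent f -> O f -> O (lmul g f)) ->
  O f -> O (lmul (lexp g i) f).
Proof.
move=> gl fl Og Of; elim: i => [|i IH]; first by rewrite lmul1.
have gil : laurent (lexp g i) by have [A gA] := gl; exists (A * i%:Z); exact: tpow_lexp.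
by rewrite lexpS -lmulA//; apply: Og => //; exact: laurent_lmul.
Qed.

Let curve_ring_mulz f : laurent f -> O f -> O (lmul z f).
Proof.
move=> fl Of; have lx i : laurent (lexp x i).
  by have [A gA] := x_laurent; exists (A * i%:Z); exact: tpow_lexp.
have ly i : laurent (lexp y i).
  by have [A gA] := y_laurent; exists (A * i%:Z); exact: tpow_lexp.
rewrite lmulC lmulDr//; have [_ H] := curve_ring_subspace period_gt0 q_gt0 xE y_low.
apply: H; rewrite lmulC; apply: curve_ring_lexp => // g _; first exact: (curve_ring_mulx period_gt0 q_gt0 xE y_low).
exact: (curve_ring_muly period_gt0 q_gt0 xE y_low).
Qed.

(** From p * a on, every exponent e is the order of a product x^i z^j with j <
    p: take for j the residue of e, as the order a of z is 1 mod p. So f is a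
    combination of such products, found by successive elimination of leading
    terms. Sorted by j it reads f = sum_(j < p) P_j z^j, where P_j is a power
    series in x. *)
Lemma curve_ring_conductor : tpow (p * a)%N%:Z `<=` O.
Proof.
move=> f fc; pose c0 := (p * a)%N.
have lead0 : lead != 0 := y_next.
have aC j : (j * a)%N%:Z = a%:Z * j%:Z by rewrite -PoszM mulnC.
pose v s k := lexp z (s %% p)%N (k - (c0 + s)%N%:Z + (s %% p * a)%N%:Z) / lead ^+ (s %% p)%N.
have v1 s : v s (c0 + s)%N%:Z = 1.
  rewrite /v subrr add0r aC lexp_leadX// z_lead divff//.
  exact: expf_neq0.
have v0 s k : k < (c0 + s)%N%:Z -> v s k = 0.
  move=> ks; rewrite /v (tpow_lexp (i := (s %% p)%N) z_low) ?mul0r// aC.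
  by rewrite gtrDr subr_lt0.
pose b := tsolve (fun i k => v i (c0 + k)%N%:Z) (fun k => f (c0 + k)%N%:Z).
have fE N k : k < (c0 + N)%N%:Z -> f k = \sum_(s < N) b s * v s k.
  move=> kN; have [kc|kc] := ltP k c0%:Z.
    by rewrite fc// big1// => s _; rewrite v0 ?mulr0//; lia.
  have [i iE] : exists i, k = (c0 + i)%N%:Z by exists (absz (k - c0%:Z)%R); lia.
  have iN : (i < N)%N by move: kN; rewrite iE ltz_nat ltn_add2l.
  rewrite iE -(tsolveE (fun i k => v i (c0 + k)%N%:Z) (fun k => f (c0 + k)%N%:Z)).
  rewrite -/b (big_ord_widen N (fun s => b s * v s (c0 + i)%N%:Z) (ltnW iN)).
  rewrite [RHS](bigID (fun s : 'I_N => (s < i)%N))/= addrC; congr (_ + _).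
  rewrite (bigD1 (Ordinal iN)) ?ltnn//= v1 mulr1 big1 ?addr0// => s /andP[si /eqP sN].
  rewrite v0 ?mulr0// ltz_nat ltn_add2l ltn_neqAle leqNgt si andbT.
  by apply/eqP => e; apply: sN; apply: val_inj.
pose P j k := if [&& 0 <= k, (p %| absz k)%N & c0%:Z <= k + (j * a)%N%:Z]
  then b (absz (k + (j * a)%N%:Z - c0%:Z)%R) / lead ^+ j else 0.
have Pl j : laurent (P j).
  by exists 0 => k k0; rewrite /P leNgt k0.
have PO j : O (P j).
  by apply: (curve_ring_xseries period_gt0 q_gt0 xE y_low) => k; rewrite /P andbA => /negPf->.
have zl : laurent z by exists a%:Z.
have OP j : O (lmul (lexp z j) (P j)) by exact: curve_ring_lexp.
have -> : f = fun k => \sum_(j < p) lmul (lexp z j) (P j) k.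
  apply/funext => k; pose N := (absz (k - c0%:Z)%R).+1.
  rewrite (@fE N); last by rewrite /N; lia.
  have jc j : (j < p)%N -> (j * a <= c0)%N by move=> jp; rewrite leq_mul2r (ltnW jp) orbT.
  under [RHS]eq_bigr => j _.
    have Pj : tpow (c0 - j * a)%N%:Z (P j).
      move=> i ic; rewrite /P; case: ifP => // /and3P[_ _]; have := jc j (ltn_ord j).
      by lia.
    rewrite lmulC (lmulE Pj (tpow_lexp (i := j) z_low) (n := N)); last first.
      by rewrite -aC -PoszD subnK ?jc// /N; lia.
    over.
  rewrite exchange_big; apply: eq_bigr => s _ /=.
  have sp : (s %% p < p)%N by rewrite ltn_pmod.
  have off (c J : nat) : (J <= c)%N -> (c - J)%N%:Z + s%:Z + J%:Z = (c + s)%N%:Z.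
    by clear; lia.
  have off' (c J : nat) l : (J <= c)%N ->
      l - (c - J)%N%:Z - s%:Z = l - (c + s)%N%:Z + J%:Z.
    by clear; lia.
  have pos (c J : nat) : 0 <= (c - J)%N%:Z + s%:Z by [].
  have abs c : absz ((c + s)%N%:Z - c%:Z)%R = s by clear; lia.
  have dvdE j : (j < p)%N ->
      (p %| absz ((c0 - j * a)%N%:Z + s%:Z)%R)%N = (s %% p == j)%N.
    move=> jp; rewrite -PoszD absz_nat /dvdn -(mod0n p).
    rewrite -(eqn_modDr (j * a)) addnAC subnK ?jc// add0n /c0 mulnC modnMDl.
    rewrite (_ : j * a = j * m * p + j)%N; last by rewrite /a; ring.
    by rewrite modnMDl [(j %% p)%N]modn_small.
  rewrite (bigD1 (Ordinal sp))//= big1 ?addr0.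
    rewrite /P pos dvdE// eqxx off ?jc//= lez_nat leq_addr abs off' ?jc//.
    by rewrite /v mulrCA mulrC.
  move=> j /eqP js; rewrite /P dvdE// [X in [&& _, X & _]](_ : _ = false) ?mul0r ?andbF//.
  by apply/eqP => e; apply: js; apply: val_inj.
have Os := curve_ring_subspace period_gt0 q_gt0 xE y_low.
apply: (@subspace_sum K _ Os _ _ _ (fun (j : 'I_p) k => lmul (lexp z j) (P j) k)) => j _.
exact: OP.
Qed.

End Conductor.

(** * Codimension and orders *)

Section Codimension.
Variables (K : fieldType) (M : set (int -> K)).
Hypothesis M_sub : subspace M.
Implicit Types (f g u : int -> K).

Lemma has_ord_ex f k : laurent f -> f k != 0 -> exists2 a, a <= k & has_ord f a.
Proof.
move=> [A fA] fk.
have Ak : A <= k by rewrite leNgt; apply: contra fk => kA; rewrite fA.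
have ex : exists i : nat, f (A + i%:Z) != 0.
  by exists (absz (k - A)%R); rewrite (_ : A + _ = k)//; lia.
case: (ex_minnP ex) => i fi mini; exists (A + i%:Z).
  have : (i <= absz (k - A)%R)%N by apply: mini; rewrite (_ : A + _ = k)//; lia.
  lia.
split=> // l lA; have [/fA//|Al] := ltP l A; apply/eqP/negPn/negP => fl.
have : (i <= absz (l - A)%R)%N by apply: mini; rewrite (_ : A + _ = l)//; lia.
lia.
Qed.

(** Otherwise its order would be an order of M. *)
Lemma ord_gap0 u : laurent u -> M u -> (forall i, ord_set M i -> u i = 0) ->
  u = fun=> 0.
Proof.
move=> ul Mu u0; apply/funext => k; apply/eqP/negPn/negP => /(has_ord_ex ul)[a _ ua].
by have := ua.1; rewrite u0 ?eqxx//; exists u.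
Qed.

(** Going up, the coefficients at orders of M are cleared by elements of M, and
    the others are moved to u. *)
Lemma gap_reduce (A B : int) g : tpow B `<=` M -> tpow A g ->
  exists u, [/\ M (fun k => g k - u k), tpow A u,
    forall i, ord_set M i -> u i = 0 & forall i, B <= i -> u i = 0].
Proof.
move=> MB; have [n] := ubnP (absz (B - A)%R); elim: n A g => // n IH A g ABn gA.
have [BA|AB] := leP B A.
  exists (fun=> 0); split=> //.
  apply: MB => k kB; rewrite subr0 gA//; exact: lt_le_trans BA.
have ABn' : (absz (B - (A + 1))%R < n)%N by lia.
have next h : tpow A h -> h A = 0 -> tpow (A + 1) h.
  by move=> hA h0 k; rewrite ltzD1 le_eqVlt => /orP[/eqP->//|/hA].
have [[f Mf [fA0 fA]]|gap] := pselect (ord_set M A).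
  pose t := g A / f A.
  have hA : tpow (A + 1) (fun k => g k - t * f k).
    apply: next; last by rewrite divfK// subrr.
    by move=> k kA; rewrite gA// fA// mulr0 subrr.
  have [u [Mu uA u0 uB]] := IH _ _ ABn' hA.
  exists u; split=> //; last by move=> k kA; apply: uA; lia.
  have := subspace_add M_sub Mu (subspace_scale M_sub t Mf); congr M.
  by apply/funext => k; ring.
have hA : tpow (A + 1) (fun k => g k - g A * monom K A k).
  apply: next; last by rewrite /monom eqxx mulr1 subrr.
  by move=> k kA; rewrite gA// tpow_monom// mulr0 subrr.
have [u [Mu uA u0 uB]] := IH _ _ ABn' hA.
exists (fun k => g A * monom K A k + u k); split=> [|k kA|i Mi|i Bi].
- by move: Mu; congr M; apply/funext => k; ring.
- by rewrite tpow_monom// mulr0 add0r; apply: uA; lia.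
- rewrite u0// addr0 /monom; case: eqP => [e|]; last by rewrite mulr0.
  by case: gap; rewrite -e.
- by rewrite uB// addr0 /monom gt_eqF ?mulr0//; lia.
Qed.

Lemma sum_monom (s : seq int) c (v : 'I_c -> K) k : size s = c -> uniq s ->
  \sum_(i < c) v i * monom K (nth 0 s i) k =
  if insub (index k s) is Some j then v j else 0.
Proof.
move=> sc us; subst c; case: insubP => [j jc jE|ns].
  have ks : k \in s by rewrite -index_mem.
  rewrite (bigD1 j)//= jE nth_index// /monom eqxx mulr1 big1 ?addr0// => i ij.
  case: eqP => [e|_]; last by rewrite mulr0.
  case/eqP: ij; apply: val_inj; rewrite /= jE e index_uniq//.
rewrite big1// => i _; rewrite /monom; case: eqP => [e|_]; last by rewrite mulr0.
by case/negP: ns; rewrite e index_mem mem_nth.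
Qed.

Definition gap_seq (N L : nat) : seq int :=
  [seq i%:Z - N%:Z | i <- iota 0 L & ~~ `[< ord_set M (i%:Z - N%:Z) >]].

Lemma uniq_gap_seq N L : uniq (gap_seq N L).
Proof.
rewrite map_inj_uniq ?filter_uniq ?iota_uniq// => i j /addIr.
by case.
Qed.

Lemma mem_gap_seq N L k : (k \in gap_seq N L) =
  [&& - N%:Z <= k, k < L%:Z - N%:Z & ~~ `[< ord_set M k >]].
Proof.
apply/mapP/and3P => [[j]|[k1 k2 k3]].
  by rewrite mem_filter mem_iota => /and3P[gi _ jL] ->; split=> //; lia.
exists (absz (k + N%:Z)%R); last by lia.
rewrite mem_filter mem_iota (_ : _ - N%:Z = k) ?k3; lia.
Qed.

(** The monomials at the gaps of M are a basis of the quotient: gap_reduce gives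
    coordinates, and ord_gap0 their uniqueness. *)
Lemma has_codim_gaps N L : tpow (L%:Z - N%:Z) `<=` M ->
  has_codim N M (size (gap_seq N L)).
Proof.
move=> ML; set s := gap_seq N L; have us : uniq s by exact: uniq_gap_seq.
exists (fun i : 'I_(size s) => monom K (nth 0 s i)); split.
  move=> i; have : nth 0 s i \in s by rewrite mem_nth.
  rewrite mem_gap_seq => /and3P[Ni _ _]; apply: (tpow_le Ni); exact: tpow_monom.
move=> f fN; have [u [Mu uN u0 uL]] := gap_reduce ML fN.
exists (\row_i u (nth 0 s i)); split=> [|v Mv].
  move: Mu; congr M; apply/funext => k; congr (_ - _).
  under eq_bigr => i _ do rewrite mxE.
  rewrite (@sum_monom s _ (fun i : 'I_(size s) => u (nth 0 s i)))//.
  case: insubP => [j ks ->|ns]; first by rewrite nth_index// -index_mem.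
  apply/eqP/negPn/negP => uk; case/negP: ns; rewrite index_mem mem_gap_seq.
  apply/and3P; split.
  - by rewrite leNgt; apply: contra uk => /uN ->.
  - by rewrite ltNge; apply: contra uk => /uL ->.
  - by apply: contra uk => /asboolP/u0 ->.
have D := subspace_sub M_sub Mv Mu.
apply/rowP => j; rewrite mxE.
pose g k := (f k - \sum_(i < size s) v 0 i * monom K (nth 0 s i) k) - (f k - u k).
have gE k : g k = u k - \sum_(i < size s) v 0 i * monom K (nth 0 s i) k.
  by rewrite /g; ring.
have g0 : g = fun=> 0.
  apply: ord_gap0 => //.
    exists (- N%:Z) => k kN; rewrite gE uN// sum_monom//.
    case: insubP => [i ks iE|_]; last by rewrite subrr.
    move: ks; rewrite index_mem mem_gap_seq => /and3P[]; lia.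
  move=> i Mi; rewrite gE u0// sum_monom//; case: insubP => [l ls|_]; last by rewrite subrr.
  by move: ls; rewrite index_mem mem_gap_seq => /and3P[_ _ /negP[]]; apply/asboolP.
have := gE (nth 0 s j); rewrite g0 sum_monom// index_uniq//.
case: insubP => [l _ lE|]; last by rewrite ltn_ord.
by move/eqP; rewrite eq_sym subr_eq0 => /eqP->; congr (v 0 _); exact: val_inj.
Qed.

(** The matrix that expresses one basis of the quotient in the other is row-
    free. *)
Lemma has_codim_le N c1 c2 : has_codim N M c1 -> has_codim N M c2 -> (c1 <= c2)%N.
Proof.
move=> [e1 [e1N ex1]] [e2 [e2N ex2]].
have /choice[P PE] : forall i : 'I_c1, exists u : 'rV[K]_c2,
    M (fun k => e1 i k - \sum_(j < c2) u 0 j * e2 j k).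
  by move=> i; have [u [Mu _]] := ex2 _ (e1N i); exists u.
pose A := \matrix_i P i.
have /eqP <- : row_free A; last exact: rank_leq_col.
apply: inj_row_free => v vA.
have Mv : M (fun k => \sum_(i < c1) v 0 i * e1 i k).
  have : M (fun k => \sum_(i < c1) v 0 i * (e1 i k - \sum_(j < c2) P i 0 j * e2 j k)).
    by apply: (subspace_sum M_sub) => i _; exact: subspace_scale.
  congr M; apply/funext => k; under eq_bigr => i _ do rewrite mulrBr mulr_sumr.
  rewrite sumrB exchange_big /= [X in _ - X]big1 ?subr0// => j _.
  under eq_bigr => i _ do rewrite mulrA.
  rewrite -mulr_suml; have /rowP/(_ j) := vA; rewrite !mxE.
  by under eq_bigr => i _ do rewrite mxE; move=> ->; rewrite mul0r.
have z : tpow (- N%:Z) (fun _ : int => 0 : K) by [].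
have [w [_ wU]] := ex1 _ z.
transitivity w.
  apply/esym/wU; have := subspace_scale M_sub (-1) Mv; congr M; apply/funext => k.
  by rewrite mulN1r sub0r.
apply: wU; move: M_sub.1; congr M; apply/funext => k.
by rewrite big1 ?subrr// => i _; rewrite mxE mul0r.
Qed.

Lemma has_codim_unique N c1 c2 : has_codim N M c1 -> has_codim N M c2 -> c1 = c2.
Proof. by move=> h1 h2; apply/eqP; rewrite eqn_leq !(@has_codim_le N). Qed.

(** The orders in the window are counted by the elements of D below L'. This
    holds also if - N lies above s, when all of D lies above the difference. *)
Lemma size_gap_seq N L (s : int) (D : set nat) (L' : nat) :
  ord_set M = [set s + e%:Z | e in D] -> M `<=` tpow (- N%:Z) ->
  L%:Z = s + N%:Z + L'%:Z ->
  (size (gap_seq N L))%:Z =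
    N%:Z + s + (count (fun e => ~~ `[< D e >]) (iota 0 L'))%:Z.
Proof.
move=> oE MN LE.
have DN e : D e -> 0 <= s + N%:Z + e%:Z.
  move=> De; have [f Mf [fe _]] : ord_set M (s + e%:Z) by rewrite oE; exists e.
  have : ~ (s + e%:Z < - N%:Z) by move=> /(MN _ Mf) f0; rewrite f0 eqxx in fe.
  lia.
have ordE i : ord_set M (i%:Z - N%:Z) <-> exists2 e, D e & i%:Z = s + N%:Z + e%:Z.
  rewrite oE; split=> -[e De eE]; exists e => //; lia.
rewrite size_map size_filter.
have cPC (P : pred nat) l : (count P (iota 0 l) + count (fun i => ~~ P i) (iota 0 l) = l)%N.
  by rewrite -[RHS](size_iota 0 l) -(count_predC P).
have cO := cPC (fun i : nat => `[< ord_set M (i%:Z - N%:Z) >]) L.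
have cD := cPC (fun e => `[< D e >]) L'.
suff e : count (fun i : nat => `[< ord_set M (i%:Z - N%:Z) >]) (iota 0 L) =
         count (fun e => `[< D e >]) (iota 0 L').
  by rewrite e in cO; move: cO cD LE; clear; lia.
have [oN|oN] := leP 0 (s + N%:Z).
  have [t tE] : exists t : nat, s + N%:Z = t%:Z by exists (absz (s + N%:Z)%R); lia.
  have -> : L = (t + L')%N by lia.
  rewrite iotaD count_cat add0n (_ : count _ (iota 0 t) = 0%N) ?add0n.
    rewrite -{1}[t]addn0 iotaDl count_map; apply: eq_count => e /=.
    apply/asboolP/asboolP => [/ordE[e' De' eE]|De]; last by apply/ordE; exists e => //; lia.
    by have -> : e = e' by lia.
  apply/eqP; rewrite -leqn0 leqNgt -has_count; apply/hasPn => i.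
  rewrite mem_iota => it; apply/negP => /asboolP/ordE[e _]; lia.
have [t tE] : exists t : nat, s + N%:Z = - t%:Z by exists (absz (s + N%:Z)%R); lia.
have -> : L' = (t + L)%N by lia.
rewrite [in RHS]iotaD count_cat add0n (_ : count _ (iota 0 t) = 0%N) ?add0n.
  rewrite -{1}[t]addn0 iotaDl count_map; apply: eq_count => i /=.
  apply/asboolP/asboolP => [/ordE[e De eE]|De]; last by apply/ordE; exists (t + i)%N => //; lia.
  by have -> : (t + i)%N = e by lia.
apply/eqP; rewrite -leqn0 leqNgt -has_count; apply/hasPn => i.
rewrite mem_iota => it; apply/negP => /asboolP/DN; lia.
Qed.

End Codimension.

(** * Modules given by generators *)

Section Expansion.
Variables (K : fieldType) (c : nat -> nat -> K).
Hypothesis c0 : forall r, c r 0%N = 1.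

(** The series t^e sum_k c e k t^k. *)
Definition fgen (e : nat) : int -> K :=
  fun k => if e%:Z <= k then c e (absz (k - e%:Z)%R) else 0.

(** The series sum_e b e * fgen e, where only the terms that contribute to the
    coefficient are summed. *)
Definition expand (b : nat -> K) : int -> K :=
  fun k => if 0 <= k then \sum_(e < (absz k).+1) b e * fgen e k else 0.

Lemma fgen_low e : tpow e%:Z (fgen e).
Proof. by move=> k ke; rewrite /fgen leNgt ke. Qed.

Lemma fgen_lead e : fgen e e%:Z = 1.
Proof. by rewrite /fgen lexx subrr c0. Qed.

Lemma fgenD e k : fgen e (e + k)%N%:Z = c e k.
Proof. by rewrite /fgen lez_nat leq_addr PoszD addrC addKr. Qed.

Lemma fgen_laurent e : laurent (fgen e).
Proof. by exists e%:Z; exact: fgen_low. Qed.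

Lemma expandE b N k : k < N%:Z -> expand b k = \sum_(e < N) b e * fgen e k.
Proof.
move=> kN; rewrite /expand; case: ifP => k0; last first.
  by rewrite big1// => e _; rewrite fgen_low ?mulr0//; lia.
have kN' : ((absz k).+1 <= N)%N by lia.
rewrite (big_ord_widen N (fun e => b e * fgen e k) kN').
rewrite big_mkcond; apply: eq_bigr => e _; case: ifP => // ek.
by rewrite fgen_low ?mulr0//; lia.
Qed.

Lemma expandS b k : expand b k%:Z = b k + \sum_(e < k) b e * fgen e k%:Z.
Proof.
rewrite (@expandE b k.+1); last by rewrite ltz_nat.
by rewrite big_ord_recr /= fgen_lead mulr1 addrC.
Qed.

Lemma expand_tpow0 b : tpow 0 (expand b).
Proof. by move=> k k0; rewrite (@expandE b 0%N)// big_ord0. Qed.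

Lemma expand_exists f : tpow 0 f -> exists b, f = expand b.
Proof.
move=> f0; pose b := tsolve (fun e k => fgen e k%:Z) (fun k => f k%:Z).
exists b; apply/funext => -[k|k]; last by rewrite f0// expand_tpow0.
rewrite expandS; exact/esym/(tsolveE (fun e k => fgen e k%:Z) (fun k => f k%:Z)).
Qed.

Lemma expand_agree b b' N : (forall k : nat, (k < N)%N -> expand b k%:Z = expand b' k%:Z) ->
  forall k, (k < N)%N -> b k = b' k.
Proof.
move=> E; apply: (@tsolve_unique _ (fun e k => fgen e k%:Z) (fun k => expand b k%:Z)).
  by move=> k _; rewrite expandS.
by move=> k kN; rewrite E// expandS.
Qed.

Lemma expand_inj b b' k : expand b = expand b' -> b k = b' k.
Proof. by move=> E; apply: (@expand_agree b b' k.+1) => // l _; rewrite E. Qed.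

Lemma expand_delta e : expand (fun i => (i == e)%:R) = fgen e.
Proof.
apply/funext => k; have kN : k < (absz k + e.+1)%N%:Z by lia.
rewrite (expandE _ kN); have eN : (e < absz k + e.+1)%N by lia.
rewrite (bigD1 (Ordinal eN))//= eqxx mul1r big1 ?addr0// => i /eqP ie.
by case: eqP => [e'|_]; rewrite ?mul0r//; case: ie; apply: val_inj.
Qed.

Lemma expand_approx b N :
  tpow N%:Z (fun k => expand b k - \sum_(e < N) b e * fgen e k).
Proof. by move=> k kN; rewrite (expandE _ kN) subrr. Qed.

Lemma expand_laurent b : laurent (expand b).
Proof. by exists 0; exact: expand_tpow0. Qed.

Section Closed.
Variables (M : set (int -> K)) (b : nat -> K).
Hypothesis M_sub : subspace M.
Hypothesis M_closed : tclosed M.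

Lemma lmul_lincomb g (s : seq nat) : laurent g ->
  lmul g (fun k => \sum_(e <- s) b e * fgen e k) =
  fun k => \sum_(e <- s) b e * lmul g (fgen e) k.
Proof.
move=> gl; elim: s => [|e s IH].
  have -> : (fun k => \sum_(e <- [::]) b e * fgen e k) = fun=> 0.
    by apply/funext => k; rewrite big_nil.
  apply/funext => k; rewrite big_nil /lmul.
  by rewrite fsbig1// => i _; rewrite mulr0.
have -> : (fun k => \sum_(e <- e :: s) b e * fgen e k) =
    fun k => b e * fgen e k + \sum_(e <- s) b e * fgen e k.
  by apply/funext => k; rewrite big_cons.
rewrite lmulDr//; [|exact: fgen_laurent|]; last first.
  exists 0 => k k0; rewrite big1// => i _; rewrite fgen_low ?mulr0//; lia.
by apply/funext => k; rewrite IH big_cons.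
Qed.

(** M is closed, and the product with g is a limit of products with finite sums. *)
Lemma lmul_expand_closed g : laurent g ->
  (forall e, b e != 0 -> M (lmul g (fgen e))) -> M (lmul g (expand b)).
Proof.
move=> gl gM; apply: M_closed => [|N].
  exact: laurent_lmul gl (expand_laurent b).
have [A gA] := gl; pose n := absz (N - A)%R.
exists (fun k => \sum_(e < n) b e * lmul g (fgen e) k).
  apply: (@subspace_sum K M M_sub _ _ _ (fun (e : 'I_n) k => b e * lmul g (fgen e) k)) => e _.
  have [->|be] := eqVneq (b e) 0.
    have -> : (fun k => 0 * lmul g (fgen e) k) = fun=> 0.
      by apply/funext => k; rewrite mul0r.
    by case: M_sub.
  by apply: (subspace_scale M_sub); exact: gM.
have E : (fun k => \sum_(e < n) b e * lmul g (fgen e) k) =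
         lmul g (fun k => \sum_(e < n) b e * fgen e k).
  have := lmul_lincomb (iota 0 n) gl.
  have sE (F : nat -> int -> K) : (fun k => \sum_(e <- iota 0 n) F e k) =
      fun k => \sum_(e < n) F e k.
    by apply/funext => k; rewrite -{1}[n]subn0 -/(index_iota 0 n) big_mkord.
  by rewrite !sE => ->.
pose r k := expand b k - \sum_(e < n) b e * fgen e k.
have r_low : tpow n%:Z r by exact: expand_approx.
have s_low : laurent (fun k => \sum_(e < n) b e * fgen e k).
  by exists 0 => k k0; rewrite big1// => i _; rewrite fgen_low ?mulr0//; lia.
have rE : expand b = fun k => 1 * r k + \sum_(e < n) b e * fgen e k.
  by apply/funext => k; rewrite mul1r /r subrK.
have gE : lmul g (expand b) = fun k => 1 * lmul g r k +
    lmul g (fun k => \sum_(e < n) b e * fgen e k) k.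
  by rewrite [in LHS]rE lmulDr//; exists n%:Z.
move=> k kN; have /(congr1 (@^~ k))/= -> := E; rewrite gE.
rewrite mul1r addrK; apply: (tpow_lmul gA r_low).
by rewrite /n; lia.
Qed.

Lemma expand_closed : (forall e, b e != 0 -> M (fgen e)) -> M (expand b).
Proof.
move=> fM; rewrite -[expand b]lmul1; apply: lmul_expand_closed => [|e /fM].
  exact: laurent_monom.
by rewrite lmul1.
Qed.

End Closed.

Variable Delta : set nat.

(** The closed span of the series fgen e with e in Delta. For c normalized these
    are the reduced generators and their products with powers of x. *)
Definition gen_module : set (int -> K) :=
  [set f | exists2 b, (forall e, ~ Delta e -> b e = 0) & f = expand b].

Lemma gen_module_laurent : gen_module `<=` @laurent K.
Proof. by move=> _ [b _ ->]; exact: expand_laurent. Qed.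

Lemma gen_module_tpow0 : gen_module `<=` tpow 0.
Proof. by move=> _ [b _ ->]; exact: expand_tpow0. Qed.

Lemma gen_module_subspace : subspace gen_module.
Proof.
split.
  exists (fun=> 0) => //; apply/funext => k; rewrite (@expandE _ (absz k).+1) ?big1//.
    by move=> e _; rewrite mul0r.
  lia.
move=> t _ _ [b bD ->] [b' bD' ->]; exists (fun e => t * b e + b' e).
  by move=> e eD; rewrite bD// bD'// mulr0 addr0.
apply/funext => k; have kN : k < (absz k).+1%:Z by lia.
rewrite !(expandE _ kN) mulr_sumr -big_split; apply: eq_bigr => e _ /=.
by rewrite mulrDl mulrA.
Qed.

Lemma gen_module_expand b e : gen_module (expand b) -> ~ Delta e -> b e = 0.
Proof. by move=> [b' bD' /expand_inj ->]; exact: bD'. Qed.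

(** Each coefficient b e depends on finitely many coefficients of the series. *)
Lemma gen_module_closed : tclosed gen_module.
Proof.
move=> f _ fM; have f0 : tpow 0 f.
  move=> k k0; have [g Mg fg] := fM 0.
  by have := fg k k0; rewrite (gen_module_tpow0 Mg)// subr0.
have [b fE] := expand_exists f0; exists b => // e eD.
have [_ [b' bD' ->] fg] := fM e.+1%:Z.
rewrite (@expand_agree b b' e.+1) ?bD'// => k ke; apply/eqP.
by rewrite -subr_eq0 -fE fg.
Qed.

Lemma gen_module_fgen e : Delta e -> gen_module (fgen e).
Proof.
move=> De; rewrite -expand_delta; exists (fun i => (i == e)%:R) => // i iD.
by case: eqP => // ie; case: iD; rewrite ie.
Qed.

Lemma gen_module_ord : ord_set gen_module = Posz @` Delta.
Proof.
apply/seteqP; split=> [a [f Mf [fa flow]]|_ [e De <-]]; last first.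
  exists (fgen e); first exact: gen_module_fgen.
  by split; [rewrite fgen_lead oner_eq0|exact: fgen_low].
have a0 : 0 <= a.
  by rewrite leNgt; apply: contra fa => a0; rewrite (gen_module_tpow0 Mf).
case: a a0 fa flow => // a _ fa flow; have [b bD fE] := Mf.
exists a => //; apply: contrapT => nD; case/eqP: fa.
rewrite fE expandS bD// add0r big1// => e _.
rewrite (@expand_agree b (fun=> 0) a) ?mul0r// => k ka; rewrite -fE flow//.
by rewrite expandS add0r big1// => i _; rewrite mul0r.
Qed.

End Expansion.

(** * Points of the stratum *)

Section Stratum.
Variables (K : fieldType) (m n d : nat) (x y : int -> K).
Variables (Delta : set nat) (gen : nat -> nat).
Local Notation p := (n * d)%N.
Local Notation q := (m * d)%N.
Hypothesis n_gt0 : (0 < n)%N.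
Hypothesis d_gt0 : (0 < d)%N.
Hypothesis m_gt0 : (0 < m)%N.
Hypothesis xE : x = @monom K p%:Z.
Hypothesis y_low : tpow q%:Z y.
Hypothesis y_lead : y q%:Z = 1.
Hypothesis gen_per : forall r, gen (r + p)%N = gen r.
Hypothesis gen_mod : forall r, gen r = r %[mod p].
Hypothesis gen_inv : forall r, (gen (r + q) <= gen r + q)%N.
Hypothesis DeltaE : forall e, Delta e <-> (gen e <= e)%N.
Let lam k := y (q + k)%N%:Z.
Local Notation normalized := (normalized n d gen).
Local Notation relations := (relations m d gen lam).
Local Notation ycoef := (ycoef q lam).

Let period_gt0 : (0 < p)%N. Proof. by rewrite muln_gt0 n_gt0. Qed.
Let q_gt0 : (0 < q)%N. Proof. by rewrite muln_gt0 m_gt0. Qed.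
Let x_laurent : laurent x. Proof. by rewrite xE; exact: laurent_monom. Qed.
Let y_laurent : laurent y. Proof. by exists q%:Z. Qed.
Let lam0 : lam 0%N = 1. Proof. by rewrite /lam addn0. Qed.

Lemma gen_idem r k : gen (gen r + k)%N = gen (r + k)%N.
Proof. by apply: (per_eqmod gen_per); rewrite -modnDml gen_mod modnDml. Qed.

Lemma Delta_gen r : Delta (gen r).
Proof. by apply/DeltaE; rewrite -[X in gen X]addn0 gen_idem addn0. Qed.

Lemma Delta_gen_add r k : Delta (gen r + k)%N <-> ~~ vertex gen r k.
Proof.
rewrite /vertex -leqNgt; split=> [/DeltaE|E]; first by rewrite gen_idem.
by apply/DeltaE; rewrite gen_idem.
Qed.

Section Module.
Variable c : nat -> nat -> K.
Hypothesis c_norm : normalized c.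
Let c0 r : c r 0%N = 1. Proof. by case: c_norm. Qed.
Let cp r k : c (r + p)%N k = c r k. Proof. by case: c_norm. Qed.

Lemma fgen_mulx e : lmul x (fgen c e) = fgen c (e + p).
Proof.
apply/funext => k; rewrite xE lmul_monom /fgen lerBrDr -PoszD.
by case: ifP => // _; rewrite cp; congr (c _ (absz _)); rewrite PoszD; ring.
Qed.

(** This is what ycoef was made for. *)
Lemma fgen_muly e :
  lmul y (fgen c e) =
  expand c (fun i => if (e + q <= i)%N then ycoef c e (i - (e + q)) else 0).
Proof.
apply/funext => k; have [ke|ke] := ltP k (e + q)%N%:Z.
  rewrite (tpow_lmul y_low (@fgen_low _ c e)); last by rewrite -PoszD addnC.
  have kN : k < (e + q)%N%:Z by [].
  rewrite (expandE _ _ kN) big1// => i _.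
  by rewrite leqNgt ltn_ord mul0r.
have [l kE] : exists l, k = (e + q + l)%N%:Z by exists (absz (k - (e + q)%N%:Z)%R); lia.
rewrite (@lmulE _ q%:Z e%:Z l.+1)//; [|exact: fgen_low|by rewrite kE; lia].
rewrite (@expandE _ c _ (e + q + l.+1)); last by rewrite kE ltz_nat; lia.
rewrite big_split_ord /= [X in _ = X + _]big1 ?add0r => [|i _]; last first.
  by rewrite leqNgt ltn_ord mul0r.
have hE := ycoefE q lam c e l.
have -> : \sum_(i < l.+1) y (q%:Z + i%:Z) * fgen c e (k - q%:Z - i%:Z) =
          \sum_(i < l.+1) lam i * c e (l - i)%N.
  apply: eq_bigr => i _; rewrite /lam PoszD -(fgenD c e (l - i)).
  congr (_ * fgen _ _ _); rewrite kE; have := ltn_ord i; lia.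
have -> : \sum_(i < l.+1)
    (if (e + q <= e + q + i)%N then ycoef c e (e + q + i - (e + q)) else 0) *
     fgen c (e + q + i) k =
  \sum_(i < l.+1) ycoef c e i * c (e + q + i)%N (l - i)%N.
  apply: eq_bigr => i _; rewrite leq_addr addKn; congr (_ * _).
  rewrite -(fgenD c); congr (fgen c _ _); rewrite kE; have := ltn_ord i; lia.
by rewrite [RHS]big_ord_recr /= subnn c0 mulr1 hE addrC subrK.
Qed.

Lemma ycoef_gen r k : ycoef c (gen r) k = ycoef c r k.
Proof.
apply: (per_eqmod (n := n) (d := d) (F := fun s => ycoef c s k)) => // s.
exact: ycoef_per.
Qed.

(** A coefficient of y * fgen e that would leave the module is given by a
    relation, as gen e + q + k is outside Delta if e + q + k is. *)
Lemma gen_module_stratum : relations c -> J_stratum x y Delta (gen_module c Delta).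
Proof.
move=> S; have Ms := gen_module_subspace c Delta; have Mc := gen_module_closed c0 (Delta := Delta).
split; last exact: gen_module_ord.
apply: (curve_moduleP period_gt0 q_gt0 xE y_low) => //.
- exact: gen_module_laurent.
- move=> _ [b bD ->]; apply: lmul_expand_closed => // e be; rewrite fgen_mulx.
  apply: gen_module_fgen => //; have De : Delta e.
    by apply: contrapT => /bD b0; rewrite b0 eqxx in be.
  by apply/DeltaE; rewrite gen_per; move/DeltaE: De; lia.
move=> _ [b bD ->]; apply: lmul_expand_closed => // e be; rewrite fgen_muly.
have /DeltaE De : Delta e by apply: contrapT => /bD b0; rewrite b0 eqxx in be.
eexists; last by [].
move=> i iD /=; case: ifP => // ei.
have ed : edge m d gen e (i - (e + q)).
  rewrite /edge subnKC//; apply: (@leq_trans i.+1); first by lia.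
  by rewrite ltnNge; apply/negP => /DeltaE.
have [i0|i0] := posnP (i - (e + q)); last exact: S.
by move: ed; rewrite i0 (negPf (edge0 gen_inv e)).
Qed.

End Module.

(** The difference of two reduced generators of the same order belongs to the
    module and is supported outside its orders. *)
Lemma gen_module_inj (c c' : nat -> nat -> K) : normalized c -> normalized c' ->
  gen_module c Delta = gen_module c' Delta -> forall r k, c r k = c' r k.
Proof.
move=> [c0 cp cn] [c0' cp' cn'] E r k.
have alK s k' (b : nat -> nat -> K) : (forall r k, b (r + p)%N k = b r k) -> b (gen s) k' = b s k'.
  by move=> bp; apply: (per_eqmod (n := n) (d := d) (F := b^~ k')).
have Ms := gen_module_subspace c Delta.
have M1 : gen_module c Delta (fgen c (gen r)) by apply: gen_module_fgen => //; exact: Delta_gen.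
have M2 : gen_module c Delta (fgen c' (gen r)) by rewrite E; apply: gen_module_fgen => //; exact: Delta_gen.
have D := subspace_sub Ms M1 M2.
have Z := ord_gap0 _ D.
have : (fun k => fgen c (gen r) k - fgen c' (gen r) k) = fun=> 0.
  apply: Z; first by exists (gen r)%:Z => i ir; rewrite !fgen_low// subrr.
  rewrite gen_module_ord// => _ [e De <-].
  have [ea|ae] := ltnP e (gen r); first by rewrite !fgen_low// subrr.
  move: De; rewrite -(subnKC ae) => /Delta_gen_add np.
  rewrite !fgenD !alK//.
  have [->|e0] := posnP (e - gen r); first by rewrite c0 c0' subrr.
  by rewrite cn// cn'// subrr.
move=> /(congr1 (@^~ (gen r + k)%N%:Z)); rewrite !fgenD !alK// => /eqP.
by rewrite subr_eq0 => /eqP.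
Qed.

Section FromStratum.
Variables (M : set (int -> K)) (C : nat).
Hypothesis DeltaC : forall e, (C <= e)%N -> Delta e.
Hypothesis MJ : J_stratum x y Delta M.

Let M_laurent : M `<=` @laurent K. Proof. by case: MJ => -[]. Qed.
Let M_sub : subspace M. Proof. by case: MJ => -[]. Qed.
Let M_closed : tclosed M. Proof. by case: MJ => -[]. Qed.
Let M_ord : ord_set M = Posz @` Delta. Proof. by case: MJ. Qed.
Let M_x f : M f -> M (lmul x f).
Proof.
case: MJ => -[_ _ _ H] _; apply: H; exact: (curve_ring_x period_gt0 q_gt0 xE y_low).
Qed.
Let M_y f : M f -> M (lmul y f).
Proof.
case: MJ => -[_ _ _ H] _; apply: H; exact: (curve_ring_y period_gt0 q_gt0 xE y_low).
Qed.

Lemma stratum_tpow0 : M `<=` tpow 0.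
Proof.
move=> f Mf k k0; apply/eqP/negPn/negP => /(has_ord_ex (M_laurent Mf))[a ak fa].
have : ord_set M a by exists f.
by rewrite M_ord => -[e _ ea]; lia.
Qed.

(** All integers from C on are orders of M, so a series can be approximated by
    elements of M to any order. *)
Lemma stratum_conductor : tpow C%:Z `<=` M.
Proof.
move=> f fC; apply: M_closed; first by exists C%:Z.
move=> N; pose i := absz N.
suff [g Mg fg] : exists2 g, M g & tpow (C + i)%N%:Z (fun k => f k - g k).
  by exists g => //; apply: tpow_le fg; rewrite /i; lia.
elim: i => [|i [g Mg fg]].
  exists (fun=> 0); first by case: M_sub.
  by move=> k; rewrite addn0 subr0 => /fC.
have : ord_set M (C + i)%N%:Z by rewrite M_ord; exists (C + i)%N => //; apply: DeltaC; lia.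
move=> [h Mh [hi hlow]]; pose t := (f (C + i)%N%:Z - g (C + i)%N%:Z) / h (C + i)%N%:Z.
exists (fun k => g k + t * h k).
  by apply: (subspace_add M_sub) => //; exact: subspace_scale.
move=> k; rewrite addnS intS addrC ltzD1 le_eqVlt => /orP[/eqP->|kC].
  by rewrite /t divfK// opprD addrA subrr.
by rewrite hlow// mulr0 addr0 fg.
Qed.

(** The reduced generators are given by gap_reduce. They span M, because the
    first coefficient outside Delta in the expansion of an element of M would be
    the leading coefficient of an element of M. *)
Lemma stratum_gen_module : exists c, [/\ normalized c, relations c & M = gen_module c Delta].
Proof.
have red e : exists u : int -> K, Delta e ->
    [/\ M (fun k => monom K e%:Z k - u k), tpow e%:Z u & forall i, Delta i -> u i%:Z = 0].
  have [u [Mu ue u0 _]] := gap_reduce M_sub stratum_conductor (@tpow_monom K e%:Z).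
  by exists u => De; split=> // i Di; apply: u0; rewrite M_ord; exists i.
have /choice[u uP] := red.
pose F e k := monom K e%:Z k - u e k.
have MF e : Delta e -> M (F e) by move=> /uP[].
have Flow e : Delta e -> tpow e%:Z (F e).
  by move=> /uP[_ ue _] k ke; rewrite /F ue// tpow_monom// subrr.
pose c r k := F (gen r) (gen r + k)%N%:Z.
have cN : normalized c.
  split=> [r|r k|r k k0].
  - have [_ _ u0] := uP _ (Delta_gen r).
    by rewrite /c /F /monom addn0 eqxx u0 ?subr0//; exact: Delta_gen.
  - by rewrite /c gen_per.
  - move/Delta_gen_add => Dk; have [_ _ u0] := uP _ (Delta_gen r).
    rewrite /c /F u0// subr0 /monom eqz_nat -[X in _ == X]addn0 eqn_add2l.
    by rewrite gtn_eqF.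
have [c0 cp cn] := cN.
have alK s k (b : nat -> nat -> K) : (forall r k, b (r + p)%N k = b r k) -> b (gen s) k = b s k.
  by move=> bp; apply: (per_eqmod (n := n) (d := d) (F := b^~ k)).
have fF r : fgen c (gen r) = F (gen r).
  apply/funext => k; have [kr|rk] := ltP k (gen r)%:Z.
    by rewrite fgen_low// Flow//; exact: Delta_gen.
  have [l ->] : exists l, k = (gen r + l)%N%:Z by exists (absz (k - (gen r)%:Z)%R); lia.
  by rewrite fgenD alK.
have Mfgen e : Delta e -> M (fgen c e).
  move=> /DeltaE ae.
  have [s sE] : exists s, e = (gen e + s * p)%N.
    have /eqP : e = gen e %[mod p] by rewrite gen_mod.
    rewrite eqn_mod_dvd// => /dvdnP[s sE]; exists s; lia.
  rewrite sE; elim: s {sE} => [|s IH].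
    by rewrite mul0n addn0 fF; apply: MF; exact: Delta_gen.
  by rewrite mulSn addnCA addnC -fgen_mulx//; exact: M_x.
have ME : M = gen_module c Delta.
  apply/seteqP; split=> [f Mf|_ [b bD ->]]; last first.
    apply: expand_closed => // e be; apply: Mfgen; apply: contrapT => /bD b0.
    by rewrite b0 eqxx in be.
  have [b fE] := expand_exists c0 (stratum_tpow0 Mf).
  exists b => //; elim/ltn_ind => e IH De; apply: contrapT => /eqP be.
  pose g k := f k - \sum_(i < e) b i * fgen c i k.
  have Mg : M g.
    apply: (subspace_sub M_sub) => //.
    apply: (@subspace_sum K M M_sub _ _ _ (fun (i : 'I_e) k => b i * fgen c i k)) => i _.
    have [Di|Di] := pselect (Delta i); first by apply: (subspace_scale M_sub); exact: Mfgen.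
    rewrite IH//; have := M_sub.1; congr M; apply/funext => k; by rewrite mul0r.
  have : ord_set M e%:Z.
    exists g => //; split; first by rewrite /g fE expandS// addrK.
    by rewrite /g fE; exact: expand_approx.
  by rewrite M_ord => -[e' De' [ee']]; apply: De; rewrite -ee'.
exists c; split=> // r k k0 ed.
have : M (lmul y (fgen c (gen r))) by apply: M_y; apply: Mfgen; exact: Delta_gen.
have nD : ~ Delta (gen r + q + k)%N.
  move/DeltaE; rewrite -{1}addnA gen_idem addnA leqNgt => /negP; apply; exact: ed.
rewrite fgen_muly// ME => MS; have := gen_module_expand c0 MS nD.
by rewrite leq_addr addKn ycoef_gen.
Qed.

End FromStratum.

End Stratum.

(** * Generators of an invariant subset and the dimension *)

Section Generators.
Variables (m n d : nat) (Delta : set nat).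
Local Notation p := (n * d)%N.
Local Notation q := (m * d)%N.
Hypothesis n_gt0 : (0 < n)%N.
Hypothesis d_gt0 : (0 < d)%N.
Hypothesis Delta_cofinite : cofinite Delta.
Hypothesis Delta_inv : invariant p q Delta.

Let period_gt0' : (0 < p)%N. Proof. by rewrite muln_gt0 n_gt0. Qed.

Lemma cofinite_bound : exists C, forall e, (C <= e)%N -> Delta e.
Proof.
have /finite_fsetP[X XE] := Delta_cofinite.
exists (\max_(i <- X) i).+1 => e Ce; apply: contrapT => De.
have : e \in X by have : (~` Delta) e by []; rewrite XE.
by move=> eX; move: Ce; rewrite ltnNge (@bigop.leq_bigmax_seq _ (enum_fset X) xpredT id e).
Qed.

Lemma Delta_addp s e : Delta e -> Delta (e + s * p)%N.
Proof.
move=> De; elim: s => [|s IH]; first by rewrite mul0n addn0.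
by rewrite mulSn addnCA addnC; have [] := Delta_inv IH.
Qed.

Lemma residue_meets r : exists e, `[< Delta e >] && (e %% p == r %% p)%N.
Proof.
have [C DC] := cofinite_bound; exists (r + C * p)%N; apply/andP; split.
  by apply/asboolP/DC; rewrite -[C]mul1n (leq_trans _ (leq_addl _ _))// mul1n leq_pmulr.
by rewrite addnC modnMDl.
Qed.

Definition least r := ex_minn (residue_meets r).

Lemma leastP r : [/\ Delta (least r), least r = r %[mod p] &
  forall e, Delta e -> e = r %[mod p] -> (least r <= e)%N].
Proof.
rewrite /least; case: ex_minnP => e /andP[/asboolP De /eqP er] emin; split=> //.
by move=> e' De' er'; apply: emin; apply/andP; split; [apply/asboolP|apply/eqP].
Qed.

Lemma least_mod r : least r = r %[mod p]. Proof. by case: (leastP r). Qed.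

Lemma least_eq r s : r = s %[mod p] -> least r = least s.
Proof.
move=> rs; have [Dr rr rmin] := leastP r; have [Ds ss smin] := leastP s.
by apply/eqP; rewrite eqn_leq rmin ?smin// ?rr ?ss.
Qed.

Lemma least_per r : least (r + p)%N = least r.
Proof. by apply: least_eq; rewrite modnDr. Qed.

Lemma DeltaE e : Delta e <-> (least e <= e)%N.
Proof.
have [De em emin] := leastP e; split=> [D|le]; first exact: emin.
have : least e == e %[mod p] by apply/eqP.
rewrite eq_sym eqn_mod_dvd// => /dvdnP[s sE].
by have := Delta_addp s De; have <- : e = (least e + s * p)%N by lia.
Qed.

Lemma least_inv r : (least (r + q) <= least r + q)%N.
Proof.
have [Dr rr _] := leastP r; have [_ _ smin] := leastP (r + q).
apply: smin; last by rewrite -modnDml rr modnDml.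
by have [] := Delta_inv Dr.
Qed.

Lemma generator_least b : generator p Delta b <-> b = least b.
Proof.
have [Db bb bmin] := leastP b; split=> [[D nD]|bE].
  apply/eqP; rewrite eqn_leq bmin// andbT leqNgt; apply/negP => lt.
  have : b == least b %[mod p] by apply/eqP.
  rewrite eqn_mod_dvd 1?ltnW// => /dvdnP[[|s] sE]; first by lia.
  apply: nD; split; first by lia.
  have -> : (b - p = least b + s * p)%N by lia.
  exact: Delta_addp.
split=> [|[pl D]]; first by rewrite bE.
have := bmin _ D; rewrite -bE -(modnDr (_ - p)) subnK// => /(_ erefl).
by have := period_gt0'; lia.
Qed.

Lemma num_gapsE D x : (forall k, (x + k < least (x + k))%N -> (k <= D)%N) ->
  num_gaps Delta x = (\sum_(k < D.+1) (x + k < least (x + k)))%N.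
Proof.
move=> Dx; pose P k := (x + k < least (x + k))%N.
have DE k : Delta (x + k)%N <-> ~~ P k by rewrite /P -leqNgt; exact: DeltaE.
pose s := [seq (x + k)%N | k <- iota 0 D.+1 & P k].
have us : uniq s by rewrite map_inj_uniq ?filter_uniq ?iota_uniq// => i j /addnI.
rewrite /num_gaps; have -> : gaps Delta x = [set` seq_fset tt s].
  apply/seteqP; split=> [e [/= re nDe]|e].
    suff : e \in seq_fset tt s by [].
    rewrite seq_fsetE; apply/mapP; exists (e - x)%N; last by rewrite subnKC.
    have pr : P (e - x)%N by apply/negPn/negP => /DE; rewrite subnKC.
    by rewrite mem_filter pr mem_iota ltnS Dx.
  have -> : [set` seq_fset tt s] e = (e \in s) :> Prop.
    by rewrite -(seq_fsetE tt s).
  move=> /mapP[k]; rewrite mem_filter => /andP[pk _] ->.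
  by split=> [|/DE]; [exact: leq_addr|rewrite pk].
rewrite set_fsetK size_seq_fset undup_id// size_map size_filter.
rewrite -sum1_count [LHS]big_mkcond -{1}[D.+1]subn0 -/(index_iota 0 D.+1) big_mkord.
by apply: eq_bigr => k _; rewrite -/(P k); case: (P k).
Qed.

Section Dimension.
Hypothesis m_gt0 : (0 < m)%N.
Hypothesis mn_coprime : coprime m n.
Variable a : 'I_d -> 'I_n -> nat.
Hypothesis aP : generators_enum Delta a.

Lemma enum_gen j i : a j i = least (a j i) /\ (a j i = j %[mod d])%N.
Proof.
have [_ aR] := aP j.
have : range (a j) (a j i) by exists i.
by rewrite aR => -[/generator_least].
Qed.

(** Each residue class mod p contains exactly one of the generators a j i. *)
Lemma sum_enum (F : nat -> nat) :
  (\sum_(j < d) \sum_(i < n) F (a j i) = \sum_(r < p) F (least r))%N.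
Proof.
rewrite pair_bigA /=.
pose h (ji : 'I_d * 'I_n) : 'I_p := Ordinal (ltn_pmod (a ji.1 ji.2) period_gt0').
have lh ji : least (h ji) = a ji.1 ji.2.
  by rewrite [RHS](enum_gen _ _).1; apply: least_eq; rewrite modn_mod.
have hinj : injective h.
  move=> [j i] [j' i'] /(congr1 (fun r : 'I_p => least r)); rewrite !lh /= => E.
  have jj' : j = j'.
    have [_ e1] := enum_gen j i; have [_ e2] := enum_gen j' i'.
    by apply: val_inj; move: e1; rewrite E e2 !modn_small.
  by subst j'; have [ainj _] := aP j; rewrite (ainj _ _ E).
have hbij : bijective h.
  by apply: inj_card_bij => //; rewrite card_prod !card_ord mulnC.
rewrite (reindex h) /=; last exact: onW_bij.
by apply: eq_bigr => ji _; rewrite lh.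
Qed.

Lemma stratum_dimE D :
  (forall r k, vertex least r k -> (k <= D)%N) ->
  stratum_dim m Delta a =
  (\sum_(r < p) (\sum_(k < D.+1) vertex least r k - \sum_(k < D.+1) edge m d least r k))%N.
Proof.
move=> HD; rewrite /stratum_dim.
rewrite (sum_enum (fun e => num_gaps Delta e - num_gaps Delta (e + q))%N).
apply: eq_bigr => r _.
have lE k : least (least r + k)%N = least (r + k)%N.
  by apply: least_eq; rewrite -modnDml least_mod modnDml.
have lqE k : least (least r + q + k)%N = least (r + q + k)%N by rewrite -!addnA lE.
have HE k : edge m d least r k -> vertex least r k.
  have := least_inv (r + k); rewrite /edge /vertex [(r + k + q)%N]addnAC; lia.
rewrite (@num_gapsE D) => [|k]; last by rewrite lE; exact: HD.
rewrite (@num_gapsE D) => [|k]; last by rewrite lqE => /HE; exact: HD.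
by congr (_ - _)%N; apply: eq_bigr => k _; rewrite /vertex /edge ?lE ?lqE.
Qed.

Lemma stratum_dim_free :
  (forall j, exists2 r, same_block d r j & (least (r + q + 1) <= least r + q + 1)%N) ->
  stratum_dim m Delta a =
  (\sum_(r < p) \sum_(k < (depth n d least).+1) free m n d least r k)%N.
Proof.
move=> adm; have pd r k := @vertex_depth m n d least n_gt0 d_gt0 least_per m_gt0 mn_coprime r k.
rewrite (stratum_dimE pd) sumnB.
  rewrite -(@count_free m n d least)// ?addnK//; [exact: least_per|exact: least_inv].
move=> r _; apply: leq_sum => k _.
by case: (boolP (edge _ _ _ _ _)) => // /(edge_source n_gt0 d_gt0 least_inv) ->.
Qed.

Lemma admissible_least : admissible m Delta a ->
  forall j, exists2 r, same_block d r j & (least (r + q + 1) <= least r + q + 1)%N.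
Proof.
move=> adm j; have [i Di] := adm (Ordinal (ltn_pmod j d_gt0)).
have [e1 e2] := enum_gen (Ordinal (ltn_pmod j d_gt0)) i.
exists (a (Ordinal (ltn_pmod j d_gt0)) i); first by rewrite /same_block e2 /= modn_mod.
by rewrite -e1; exact/DeltaE.
Qed.

End Dimension.

End Generators.

(** * Translates in the compactified Jacobian *)

Section Shift.
Variable K : fieldType.
Implicit Types (f g : int -> K) (M : set (int -> K)).

Lemma shiftP s M f : shift s M f <-> M (fun k => f (k + s)).
Proof.
split=> [[g Mg <-]|Mf].
  by move: Mg; congr M; apply/funext => k; rewrite addrK.
by exists (fun k => f (k + s)) => //; apply/funext => k; rewrite subrK.
Qed.

Lemma shift_inj s M M' : shift s M = shift s M' -> M = M'.
Proof.
move=> E; apply/seteqP; split=> f Mf.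
  have : shift s M (fun k => f (k - s)) by exists f.
  by rewrite E => /shiftP; congr M'; apply/funext => k; rewrite addrK.
have : shift s M' (fun k => f (k - s)) by exists f.
by rewrite -E => /shiftP; congr M; apply/funext => k; rewrite addrK.
Qed.

Lemma shift_subspace s M : subspace M -> subspace (shift s M).
Proof.
by move=> [M0 ML]; split=> [|b f g /shiftP Mf /shiftP Mg]; apply/shiftP => //; exact: ML.
Qed.

Lemma shift_ord s M (D : set nat) : ord_set M = Posz @` D ->
  ord_set (shift s M) = [set s + e%:Z | e in D].
Proof.
move=> oM; apply/seteqP; split=> [a [f /shiftP Mf [fa flow]]|_ [e De <-]].
  have : ord_set M (a - s).
    exists (fun k => f (k + s)) => //; split; first by rewrite subrK.
    by move=> k ka; apply: flow; rewrite -ltrBrDr.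
  by rewrite oM => -[e De ea]; exists e => //; rewrite ea addrC subrK.
have : ord_set M e%:Z by rewrite oM; exists e.
move=> [f Mf [fe flow]]; exists (fun k => f (k - s)); first by exists f.
split; first by rewrite [s + _]addrC addrK.
by move=> k ke; apply: flow; rewrite ltrBlDr addrC.
Qed.

Lemma shift_module x y s M : curve_module x y M ->
  M `<=` @laurent K -> (forall g, curve_ring x y g -> laurent g) ->
  curve_module x y (shift s M).
Proof.
move=> [Ml Ms Mc MO] _ Ol.
have sl f A : tpow A (fun k => f (k + s)) -> tpow (A + s) f.
  by move=> fA k kA; have := fA (k - s); rewrite subrK; apply; rewrite ltrBlDr.
split.
- by move=> f /shiftP/Ml[A /sl fA]; exists (A + s).
- exact: shift_subspace.
- move=> f [A fA] fM; apply/shiftP; apply: Mc.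
    by exists (A - s) => k kA; apply: fA; rewrite -ltrBrDr.
  move=> N; have [g /shiftP Mg fg] := fM (N + s).
  by exists (fun k => g (k + s)) => // k kN; apply: fg; rewrite ltrD2r.
- move=> g f Og /shiftP Mf; apply/shiftP; have := MO _ _ Og Mf; congr M.
  apply/funext => k; rewrite /lmul; apply: eq_fsbigr => i _.
  by rewrite addrAC.
Qed.

Lemma shift_tpow s M A : M `<=` tpow A -> shift s M `<=` tpow (A + s).
Proof.
move=> MA f /shiftP/MA fA k kA; have := fA (k - s); rewrite subrK; apply.
by rewrite ltrBlDr.
Qed.

Lemma tpow_shift s M A : tpow A `<=` M -> tpow (A + s) `<=` shift s M.
Proof.
by move=> AM f fA; apply/shiftP; apply: AM => k kA; apply: fA; rewrite ltrD2r.
Qed.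

End Shift.

Section Jacobian.
Variables (K : fieldType) (x y : int -> K) (Delta : set nat) (C E : nat).
Hypothesis O_sub : subspace (curve_ring x y).
Hypothesis O_low : curve_ring x y `<=` tpow 0.
Hypothesis O_conductor : tpow E%:Z `<=` curve_ring x y.
Hypothesis DeltaC : forall e, (C <= e)%N -> Delta e.
Hypothesis J_conductor : forall M, J_stratum x y Delta M -> tpow C%:Z `<=` M.
Hypothesis J_low : forall M, J_stratum x y Delta M -> M `<=` tpow 0.

Let ordO : set nat := [set e | ord_set (curve_ring x y) e%:Z].
Let gapsO := count (fun e => ~~ `[< ordO e >]) (iota 0 E).
Let gapsD := count (fun e => ~~ `[< Delta e >]) (iota 0 C).

(** The codimension is N plus the number of gaps for the ring, and N + s plus
    the number of gaps of Delta for t^s M. So this is the only translation that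
    puts M into the compactified Jacobian. *)
Definition jac_shift : int := gapsO%:Z - gapsD%:Z.

Let O_codim N : has_codim N (curve_ring x y) (N + gapsO).
Proof.
have oE : ord_set (curve_ring x y) = [set 0 + e%:Z | e in ordO].
  apply/seteqP; split=> [a [f Of fa]|_ [e De <-]]; last by rewrite add0r.
  have a0 : 0 <= a.
    by rewrite leNgt; apply/negP => /(O_low Of) f0; case: fa; rewrite f0 eqxx.
  by exists (absz a); rewrite ?add0r ?gez0_abs//= /ordO /= gez0_abs//; exists f.
have ON : curve_ring x y `<=` tpow (- N%:Z).
  by move=> f /O_low f0; apply: tpow_le f0; lia.
have LE : (N + E)%N%:Z = 0 + N%:Z + E%:Z by rewrite add0r.
have := size_gap_seq oE ON LE; rewrite addr0 -PoszD => -[<-].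
by apply: has_codim_gaps => // f fE; apply: O_conductor; apply: tpow_le fE; lia.
Qed.

Let J_codim N s M : J_stratum x y Delta M -> shift s M `<=` tpow (- N%:Z) ->
  exists c, has_codim N (shift s M) c /\ c%:Z = N%:Z + s + gapsD%:Z.
Proof.
move=> JM sN; have [[Ml Ms Mc MO] Mo] := JM.
have so := shift_ord s Mo.
have sC : - N%:Z <= s + C%:Z.
  have : ord_set (shift s M) (s + C%:Z) by rewrite so; exists C => //; exact: DeltaC.
  move=> [f Mf [fC _]]; rewrite leNgt; apply: contra fC => lt.
  by rewrite (sN _ Mf).
have [L LE] : exists L : nat, L%:Z = s + N%:Z + C%:Z.
  by exists (absz (s + N%:Z + C%:Z)%R); lia.
exists (size (gap_seq (shift s M) N L)); split; last exact: size_gap_seq so sN LE.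
apply: has_codim_gaps; first exact: shift_subspace.
rewrite LE (_ : _ - N%:Z = C%:Z + s); last by ring.
by apply: tpow_shift; exact: J_conductor.
Qed.

Lemma JC_stratumP N M' : 0 <= N%:Z + jac_shift ->
  JC_stratum x y Delta N M' <->
  exists2 M, J_stratum x y Delta M & M' = shift jac_shift M.
Proof.
move=> N0; split=> [[[_ M'N [c cO cM]] [s [M JM M'E]]]|[M JM ->]].
  have [c' [cM' c'E]] := J_codim JM (eq_ind _ (fun M => M `<=` tpow (- N%:Z)) M'N _ M'E).
  have Ms : subspace M by case: JM => -[].
  rewrite M'E in cM.
  have e1 := has_codim_unique (shift_subspace s Ms) cM cM'.
  have e2 := has_codim_unique O_sub cO (O_codim N).
  exists M => //; rewrite M'E; congr (shift _ M); rewrite /jac_shift.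
  by move: c'E; rewrite -e1 e2; lia.
have [cmod _] := JM; have [Ml Ms Mc MO] := cmod.
have sN : shift jac_shift M `<=` tpow (- N%:Z).
  move=> f /(shift_tpow (J_low JM)); apply: tpow_le; lia.
split; last by exists jac_shift, M.
split=> //.
  apply: shift_module => // g Og; by exists 0; exact: O_low.
have [c [cM cE]] := J_codim JM sN; exists (N + gapsO)%N; first exact: O_codim.
suff <- : c = (N + gapsO)%N by [].
by move: cE; rewrite /jac_shift; lia.
Qed.

End Jacobian.

(** * Pluecker coordinates *)

Section Window.
Variables (K : fieldType) (Delta : set nat) (C N off L : nat) (s0 : int).
Hypothesis DeltaC : forall e, (C <= e)%N -> Delta e.
Hypothesis offE : off%:Z = N%:Z + s0.
Hypothesis LE : (off + L = N + N)%N.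
Hypothesis CL : (C <= L)%N.

(** The rows of the matrix of M modulo t^N are indexed by the elements of Delta
    below L. *)
Definition rows := [seq e <- iota 0 L | `[< Delta e >]].
Local Notation k := (size rows).

Lemma mem_rows e : (e \in rows) = `[< Delta e >] && (e < L)%N.
Proof. by rewrite mem_filter mem_iota. Qed.

Lemma uniq_rows : uniq rows. Proof. exact/filter_uniq/iota_uniq. Qed.

Lemma rows_lt (i : 'I_k) : (nth 0%N rows i < L)%N.
Proof. by have := mem_nth 0%N (ltn_ord i); rewrite mem_rows => /andP[]. Qed.

Lemma rows_Delta (i : 'I_k) : Delta (nth 0%N rows i).
Proof. by have := mem_nth 0%N (ltn_ord i); rewrite mem_rows => /andP[/asboolP]. Qed.

Lemma rows_mono (i j : 'I_k) : (i < j)%N -> (nth 0%N rows i < nth 0%N rows j)%N.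
Proof.
move=> ij; apply: (sorted_ltn_nth ltn_trans) => //; rewrite ?inE//.
by apply: sorted_filter; [exact: ltn_trans|exact: iota_ltn_sorted].
Qed.

(** Its rows are the truncations of the translates of fgen e. Here off is the
    column of the exponent 0 before translation. *)
Definition window_mx (c : nat -> nat -> K) : 'M[K]_(k, N + N) :=
  \matrix_(i, j) fgen c (nth 0%N rows i) (j%:Z - off%:Z).

Lemma col_lt e : (e < L)%N -> (e + off < N + N)%N. Proof. by rewrite -LE addnC ltn_add2l. Qed.

(** The columns of the exponents in Delta. *)
Definition pivots : {ffun 'I_k -> 'I_(N + N)} :=
  [ffun i => Ordinal (col_lt (rows_lt i))].

Definition exchange (i0 : 'I_k) (j : 'I_(N + N)) : {ffun 'I_k -> 'I_(N + N)} :=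
  [ffun i => if i == i0 then j else pivots i].

Definition minor (A : 'M[K]_(k, N + N)) (s : {ffun 'I_k -> 'I_(N + N)}) :=
  \det (\matrix_(i, j) A i (s j)).

Lemma window_pivots c i j :
  window_mx c i (pivots j) = fgen c (nth 0%N rows i) (nth 0%N rows j)%:Z.
Proof. by rewrite mxE ffunE /= PoszD addrK. Qed.

Lemma minor_mull (B : 'M[K]_k) A s : minor (B *m A) s = \det B * minor A s.
Proof.
rewrite /minor -det_mulmx; congr (\det _); apply/matrixP => i j; rewrite !mxE.
by apply: eq_bigr => l _; rewrite mxE.
Qed.

(** Row i0 is a unit vector on the pivot columns: expand both determinants along
    it. *)
Lemma minor_exchange (A : 'M[K]_(k, N + N)) (i0 : 'I_k) j :
  (forall i, A i0 (pivots i) = (i == i0)%:R) ->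
  minor A (exchange i0 j) = A i0 j * minor A pivots.
Proof.
move=> Apiv; rewrite /minor (expand_det_row _ i0) (bigD1 i0)//= big1 ?addr0; last first.
  by move=> i ii0; rewrite mxE ffunE (negPf ii0) Apiv (negPf ii0) mul0r.
rewrite [in RHS](expand_det_row _ i0) [in RHS](bigD1 i0)//= [X in _ * (_ + X)]big1; last first.
  by move=> i ii0; rewrite mxE Apiv (negPf ii0) mul0r.
rewrite addr0 !mxE ffunE eqxx Apiv eqxx mul1r; congr (_ * _).
rewrite /cofactor; congr (_ * \det _); apply/matrixP => i l; rewrite !mxE ffunE.
by rewrite eq_sym (negPf (neq_lift _ _)).
Qed.

Lemma sum_rows (F : nat -> K) : (forall e, ~ Delta e -> F e = 0) ->
  \sum_(e < L) F e = \sum_(i < k) F (nth 0%N rows i).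
Proof.
move=> F0; rewrite -(big_mkord xpredT F) -(big_mkord xpredT (fun i => F (nth 0%N rows i))).
rewrite -(big_nth 0%N xpredT F) big_filter [RHS]big_mkcond /index_iota subn0.
by apply: eq_bigr => e _; case: asboolP => // /F0.
Qed.

Section Matrix.
Variable c : nat -> nat -> K.
Hypothesis c0 : forall r, c r 0%N = 1.
Local Notation A := (window_mx c).
Local Notation M := (shift s0 (gen_module c Delta)).

(** The pivot columns form a unitriangular matrix. *)
Lemma minor_pivots : minor A pivots = 1.
Proof.
rewrite /minor; set S := \matrix_(i, j) _.
have SE i j : S i j = fgen c (nth 0%N rows i) (nth 0%N rows j)%:Z.
  by rewrite mxE window_pivots.
rewrite -det_tr det_trig.
  by apply: big1 => i _; rewrite mxE SE fgen_lead.
apply/is_trig_mxP => i j ij; rewrite mxE SE fgen_low// ltz_nat.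
exact: rows_mono.
Qed.

Lemma row_free_window : row_free A.
Proof.
have e : A *m (\matrix_(l, j) (l == pivots j)%:R) = \matrix_(i, j) A i (pivots j).
  apply/matrixP => i j; rewrite !mxE (bigD1 (pivots j))//= mxE eqxx mulr1 big1 ?addr0.
    by rewrite mxE.
  by move=> l lj; rewrite !mxE (negPf lj) mulr0.
have u : \matrix_(i, j) A i (pivots j) \in unitmx.
  by rewrite unitmxE; have := minor_pivots; rewrite /minor => ->; exact: unitr1.
rewrite /row_free eqn_leq rank_leq_row /=.
by rewrite -[X in (X <= _)%N](mxrank_unit u) -e mxrankM_maxl.
Qed.

Lemma trunc_shift (f : int -> K) (j : 'I_(N + N)) :
  trunc N f 0 j = f (j%:Z - off%:Z + s0).
Proof. by rewrite mxE; congr f; rewrite offE; ring. Qed.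

(** A series of the window with the truncation of an element of M differs from
    it beyond L, where Delta has no gap left. *)
Lemma window_basis_gen_module : window_basis M A.
Proof.
split; first exact: row_free_window.
have colL (j : 'I_(N + N)) : j%:Z - off%:Z < L%:Z by have := ltn_ord j; lia.
apply/seteqP; split=> [f /shiftP[b bD fE]|f [fN /submxP[u uE]]].
  have fbE i : f i = expand c b (i - s0) by rewrite -fE subrK.
  split=> [i iN|].
    by rewrite fbE expand_tpow0//; lia.
  apply/submxP; exists (\row_i b (nth 0%N rows i)); apply/rowP => j.
  rewrite trunc_shift fbE addrK (expandE _ _ (colL j)) mxE.
  rewrite (sum_rows (F := fun e => b e * fgen c e (j%:Z - off%:Z))).
    by apply: eq_bigr => i _; rewrite !mxE.
  by move=> e De; rewrite bD// mul0r.
apply/shiftP; set g := fun i => _.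
have gE (i : int) : - off%:Z <= i -> i < L%:Z ->
    g i = \sum_(l < k) u 0 l * fgen c (nth 0%N rows l) i.
  move=> io iL; have jlt : (absz (i + off%:Z)%R < N + N)%N by lia.
  have := trunc_shift f (Ordinal jlt); rewrite uE mxE /=.
  have -> : (absz (i + off%:Z)%R)%:Z - off%:Z = i by lia.
  by rewrite -/(g i) => <-; apply: eq_bigr => l _; rewrite !mxE /=; congr (_ * fgen _ _ _); lia.
have g0 : tpow 0 g.
  move=> i i0; have [io|io] := ltP i (- off%:Z).
    by apply: fN; rewrite offE in io; lia.
  rewrite gE//; last by lia.
  by apply: big1 => l _; rewrite fgen_low ?mulr0//; lia.
have [b gb] := expand_exists c0 g0.
exists b => // e De.
pose b' e := if insub (index e rows) is Some l then u 0 (l : 'I_k) else 0.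
have b'E (l : 'I_k) : b' (nth 0%N rows l) = u 0 l.
  rewrite /b' index_uniq ?uniq_rows//; case: insubP => [l' _ e'|]; last by rewrite ltn_ord.
  by congr (u 0 _); apply: val_inj.
have b'0 e' : ~ Delta e' -> b' e' = 0.
  move=> De'; rewrite /b'; case: insubP => // l; rewrite index_mem mem_rows => /andP[/asboolP//].
have eL : (e < L)%N by rewrite ltnNge; apply/negP => Le; apply: De; apply: DeltaC; lia.
rewrite -(b'0 e De); apply: (expand_agree c0 (N := L)) => // i iL.
rewrite -gb gE//; last by lia.
rewrite (@expandE _ c b' L); last by rewrite ltz_nat.
rewrite (sum_rows (F := fun e => b' e * fgen c e i%:Z)).
  by apply: eq_bigr => l _; rewrite b'E.
by move=> e' De'; rewrite b'0// mul0r.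
Qed.

Lemma window_basis_mul (B : 'M[K]_(k, N + N)) : window_basis M B ->
  exists P : 'M[K]_k, B = P *m A.
Proof.
move=> [_ MB]; have [_ MA] := window_basis_gen_module; apply/submxP/row_subP => i.
pose f l := if (- N%:Z <= l) then
  (if insub (absz (l + N%:Z)%R) is Some j then B i (j : 'I_(N + N)) else 0) else 0.
have fN : tpow (- N%:Z) f by move=> l lN; rewrite /f leNgt lN.
have tf : trunc N f = row i B.
  apply/rowP => j; rewrite !mxE /f ifT; last by lia.
  rewrite subrK absz_nat; case: insubP => [j' _ e|]; last by rewrite ltn_ord.
  by congr (B i _); apply: val_inj.
have : M f by rewrite MB; split=> //; rewrite tf row_sub.
by rewrite MA => -[_]; rewrite tf.
Qed.

(** A change of basis multiplies all minors by the same determinant. *)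
Lemma plucker_ratio v (i0 : 'I_k) j :
  (forall i, A i0 (pivots i) = (i == i0)%:R) ->
  plucker_coord M v -> v (exchange i0 j) = A i0 j * v pivots.
Proof.
move=> Apiv [B [b [/window_basis_mul[P ->] _ ->]]].
by rewrite -!/(minor _ _) !minor_mull minor_exchange//; ring.
Qed.

Lemma plucker_std : plucker_coord M (minor A).
Proof.
exists A, 1; split; [exact: window_basis_gen_module|exact: oner_neq0|].
by apply/funext => s; rewrite mul1r.
Qed.

End Matrix.
End Window.

(** * The isomorphism *)

Section PolynomialFunctions.
Variables (K : fieldType) (D : nat).

Definition polyfun (f : 'rV[K]_D -> K) :=
  exists P : {mpoly K[D]}, forall u, f u = P.@[fun i => u 0 i].

Lemma polyfun_ext f g : f =1 g -> polyfun f -> polyfun g.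
Proof. by move=> fg [P PE]; exists P => u; rewrite -fg. Qed.

Lemma polyfun_const b : polyfun (fun=> b).
Proof. by exists b%:MP => u; rewrite mevalC. Qed.

Lemma polyfun_add f g : polyfun f -> polyfun g -> polyfun (fun u => f u + g u).
Proof. by move=> [P PE] [Q QE]; exists (P + Q) => u; rewrite mevalD PE QE. Qed.

Lemma polyfun_mul f g : polyfun f -> polyfun g -> polyfun (fun u => f u * g u).
Proof. by move=> [P PE] [Q QE]; exists (P * Q) => u; rewrite mevalM PE QE. Qed.

Lemma polyfun_coord i : polyfun (fun u => u 0 i).
Proof. by exists 'X_i => u; rewrite mevalXU. Qed.

End PolynomialFunctions.

Section Assembly.
Variables (K : fieldType) (m n d : nat).
Local Notation p := (n * d)%N.
Local Notation q := (m * d)%N.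
Variables (x y : int -> K) (Delta : set nat) (gen : nat -> nat) (C : nat).
Hypothesis m_gt0 : (0 < m)%N.
Hypothesis n_gt0 : (0 < n)%N.
Hypothesis d_gt0 : (0 < d)%N.
Hypothesis mn_coprime : coprime m n.
Hypothesis xE : x = @monom K p%:Z.
Hypothesis y_low : tpow q%:Z y.
Hypothesis y_lead : y q%:Z = 1.
Hypothesis y_next : n%:R * y (q + 1)%N%:Z != 0.
Hypothesis gen_per : forall r, gen (r + p)%N = gen r.
Hypothesis gen_mod : forall r, gen r = r %[mod p].
Hypothesis gen_inv : forall r, (gen (r + q) <= gen r + q)%N.
Hypothesis DeltaE : forall e, Delta e <-> (gen e <= e)%N.
Hypothesis gen_adm : forall j, exists2 r, same_block d r j &
  (gen (r + q + 1) <= gen r + q + 1)%N.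
Hypothesis DeltaC : forall e, (C <= e)%N -> Delta e.

Local Notation lam := (fun k => y (q + k)%N%:Z).
Local Notation normalized := (@normalized K n d gen).
Local Notation relations := (relations m d gen lam).
Local Notation depth := (depth n d gen).
Local Notation free := (free m n d gen).
Local Notation root := (root m n d gen).
Local Notation fcoord := (free_coord m n d gen).
Local Notation gen_module c := (gen_module c Delta).

Let period_gt0 : (0 < p)%N. Proof. by rewrite muln_gt0 n_gt0. Qed.
Let q_gt0 : (0 < q)%N. Proof. by rewrite muln_gt0 m_gt0. Qed.
Let lam0 : lam 0%N = 1. Proof. by rewrite /= addn0. Qed.

Let E := (p * (m * p).+1)%N.
Let s0 := jac_shift x y Delta C E.

Lemma JC_stratum_gen_module N M' : 0 <= N%:Z + s0 -> JC_stratum x y Delta N M' <->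
  exists c, [/\ normalized c, relations c & M' = shift s0 (gen_module c)].
Proof.
move=> N0; rewrite (@JC_stratumP K x y Delta C E)//; first last.
- by move=> M JM; exact: (stratum_tpow0 n_gt0 d_gt0 m_gt0 JM).
- by move=> M JM; exact: (stratum_conductor n_gt0 d_gt0 m_gt0 DeltaC JM).
- apply: (curve_ring_conductor n_gt0 d_gt0 m_gt0 xE y_low y_lead).
  by rewrite -mulr_natl.
- exact: (curve_ring_tpow0 period_gt0 q_gt0 xE y_low).
- exact: (curve_ring_subspace period_gt0 q_gt0 xE y_low).
split=> [[M JM ->]|[c [cN cS ->]]].
  have [c [cN cS ->]] := stratum_gen_module n_gt0 d_gt0 m_gt0 xE y_low
    gen_per gen_mod DeltaE DeltaC JM.
  by exists c.
exists (gen_module c) => //; exact: (gen_module_stratum n_gt0 d_gt0 m_gt0 xE y_low gen_per gen_inv DeltaE).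
Qed.

Definition free_set : {set 'I_p * 'I_depth.+1} :=
  [set rk : 'I_p * 'I_depth.+1 | free rk.1 rk.2].
Local Notation D := #|free_set|.

Lemma card_free_set : D = (\sum_(r < p) \sum_(k < depth.+1) free r k)%N.
Proof.
rewrite pair_bigA /= -sum1_card big_mkcond; apply: eq_bigr => rk _.
by rewrite inE; case: (free _ _).
Qed.

Definition position (i : 'I_D) : 'I_p * 'I_depth.+1 := enum_val i.

Lemma position_inj : injective position. Proof. exact: enum_val_inj. Qed.

Lemma position_free i : free (position i).1 (position i).2.
Proof. by have := enum_valP i; rewrite inE. Qed.

Lemma position_onto r k : (r < p)%N -> free r k ->
  exists i, r = (position i).1 /\ k = (position i).2.
Proof.
move=> rp rk; have kd : (k < depth.+1)%N.
  by case/andP: rk => /(vertex_depth n_gt0 d_gt0 gen_per m_gt0 mn_coprime).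
have rkF : (Ordinal rp, Ordinal kd) \in free_set by rewrite inE.
exists (enum_rank_in rkF (Ordinal rp, Ordinal kd)).
by rewrite /position enum_rankK_in.
Qed.

Definition free_val (u : 'rV[K]_D) (r k : nat) : K :=
  \sum_(i < D) u 0 i *+ (((position i).1 == r :> nat) && ((position i).2 == k :> nat)).

Lemma free_valE u i : free_val u (position i).1 (position i).2 = u 0 i.
Proof.
rewrite /free_val (bigD1 i)//= !eqxx mulr1n big1 ?addr0// => j /eqP ji.
case: eqP => [e1|_]; case: eqP => [e2|_] //=; case: ji; apply: position_inj.
by case: (position i) (position j) e1 e2 => [i1 i2] [j1 j2] /= /val_inj -> /val_inj ->.
Qed.

Lemma polyfun_free_val r k : polyfun (fun u => free_val u r k).
Proof.
rewrite /free_val; apply: (Pol_sum (@polyfun_ext K D) (@polyfun_const K D)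
  (@polyfun_add K D)) => i _.
case: (_ && _); first exact: polyfun_coord.
exact: polyfun_const.
Qed.

(** The array of coefficients with prescribed parameters. *)
Definition param (u : 'rV[K]_D) : nat -> nat -> K :=
  solution m n d gen lam (free_val u) (depth * d).

Lemma paramP (c : nat -> nat -> K) (u : 'rV[K]_D) : normalized c ->
  (relations c /\ forall i, fcoord c (position i).1 (position i).2 = u 0 i) <-> c = param u.
Proof.
move=> cN; have := solutionP n_gt0 d_gt0 m_gt0 mn_coprime gen_per gen_inv gen_adm lam0 y_next (free_val u) cN.
move=> H; split=> [[cS cu]|cE].
  have [H1 _] := H; apply/funext => r; apply/funext => k; apply: H1.
  split=> // {}r {}k rp rk.
  by have [i [-> ->]] := position_onto rp rk; rewrite cu free_valE.
have [_ H2] := H; have [cS cu] := H2 (fun r k => congr1 (fun c => c r k) cE).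
split=> // i; rewrite cu ?free_valE//.
exact: position_free.
Qed.

Lemma param_norm (u : 'rV[K]_D) : normalized (param u).
Proof. exact: solution_norm. Qed.

Lemma polyfun_param r k : polyfun (fun u => param u r k).
Proof.
apply: (@Pol_solution K m n d gen lam _ _ (@polyfun_ext K D) (@polyfun_const K D)
  (@polyfun_add K D) (@polyfun_mul K D) free_val).
exact: polyfun_free_val.
Qed.

Section Window.
Variable N : nat.
Hypothesis N_large : (C + absz s0 <= N)%N.
Let off := absz (N%:Z + s0)%R.
Let L := (N + N - off)%N.
Let offE : off%:Z = N%:Z + s0. Proof. by rewrite /off; lia. Qed.
Let LE : (off + L = N + N)%N. Proof. by rewrite /L; lia. Qed.
Let CL : (C <= L)%N. Proof. by rewrite /L; lia. Qed.
Let N0 : 0 <= N%:Z + s0. Proof. by rewrite -offE. Qed.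
Local Notation k := (size (rows Delta L)).
Local Notation X := (JC_stratum x y Delta N).
Local Notation A c := (@window_mx K Delta N off L c).
Local Notation T := {ffun 'I_k -> 'I_(N + N)}.
Local Notation piv := (pivots Delta LE).

(** The row of the generator gen r is a unit vector on the pivot columns, since
    the generator is reduced. Its other entries are the unknowns. *)
Lemma ratio_coef r e : vertex gen r e -> exists s : T,
  forall c, normalized c -> forall v, @plucker_coord K N k (shift s0 (gen_module c)) v ->
  v s = c r e * v piv.
Proof.
move=> re; have DaE l : Delta (gen r + l)%N <-> ~~ vertex gen r l by exact: (Delta_gen_add gen_per gen_mod DeltaE).
have reL : (gen r + e < L)%N.
  rewrite (leq_trans _ CL)// ltnNge; apply/negP => /DeltaC/DaE.
  by rewrite re.
have rL : (gen r < L)%N by apply: leq_ltn_trans (leq_addr _ _) reL.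
have ar : gen r \in rows Delta L.
  by rewrite mem_rows rL andbT; apply/asboolP; exact: (Delta_gen gen_per gen_mod DeltaE).
have ir : (index (gen r) (rows Delta L) < k)%N by rewrite index_mem.
have jr := @col_lt N off L LE _ reL.
exists (exchange LE (Ordinal ir) (Ordinal jr)) => c cN v vM.
have [c0 cp cn] := cN.
have alK l : c (gen r) l = c r l by apply: (per_eqmod (n := n) (d := d) (F := c^~ l)).
rewrite (@plucker_ratio K Delta C N off L s0 DeltaC offE LE CL c c0 v)//.
  congr (_ * _); rewrite mxE /= nth_index// PoszD addrK fgenD; exact: alK.
move=> i; rewrite window_pivots /= nth_index//.
have [->|ii] := eqVneq i (Ordinal ir).
  by rewrite /= nth_index// fgen_lead.
have Di := rows_Delta i; set e' := nth _ _ _ in Di *.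
have [lt|ge] := ltnP e' (gen r); first by rewrite fgen_low.
move: Di; rewrite -(subnKC ge) => /DaE np; rewrite fgenD alK cn// subn_gt0 ltn_neqAle ge andbT.
apply: contra ii => /eqP are; apply/eqP/val_inj => /=.
by rewrite are /e' index_uniq// uniq_rows.
Qed.

(** The parametrization is regular because the minors of a matrix with
    polynomial entries are polynomials, and one of them is 1. Its inverse is
    regular because the parameters are differences of unknowns, hence quotients
    of linear forms in the Pluecker coordinates by the pivot minor. *)
Lemma stratum_isomorphic_affine :
  isomorphic_to_affine_space (@plucker_coord K N k) X D.
Proof.
have /choice[cof cofP] : forall M', exists c, X M' ->
    [/\ normalized c, relations c & M' = shift s0 (gen_module c)].
  move=> M'; have [XM|nX] := pselect (X M'); last by exists (fun _ _ => 0).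
  by have [c cP] := (JC_stratum_gen_module M' N0).1 XM; exists c.
pose phi u := shift s0 (gen_module (param u)).
pose psi M' : 'rV[K]_D := \row_i fcoord (cof M') (position i).1 (position i).2.
have paramS u : relations (param u) /\ forall i, fcoord (param u) (position i).1 (position i).2 = u 0 i.
  by apply/(paramP u (param_norm u)).
have Xphi u : X (phi u).
  apply/JC_stratum_gen_module => //; exists (param u); split=> //; first exact: param_norm.
  by case: (paramS u).
exists phi, psi; split=> //.
- move=> u; apply/rowP => i; rewrite mxE.
  have [cN cS cE] := cofP _ (Xphi u).
  have -> : cof (phi u) = param u.
    apply/funext => r; apply/funext => e; apply/esym.
    have ME : gen_module (param u) = gen_module (cof (phi u)) by exact: shift_inj cE.
    exact: (gen_module_inj gen_per gen_mod DeltaE (param_norm u) cN ME).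
  by case: (paramS u).
- move=> M' XM; have [cN cS ME] := cofP _ XM.
  have cE : cof M' = param (psi M').
    by apply/(paramP _ cN); split=> // i; rewrite mxE.
  by rewrite /phi -cE.
- move=> u.
  have entry (ij : 'I_k * 'I_(N + N)) : exists P : {mpoly K[D]},
      forall w : 'rV[K]_D, A (param w) ij.1 ij.2 = P.@[fun i => w 0 i].
    apply: (@polyfun_ext K D (fun w => fgen (param w) (nth 0%N (rows Delta L) ij.1) (ij.2%:Z - off%:Z))).
      by move=> w; rewrite mxE.
    rewrite /fgen; case: (_ <= _); [exact: polyfun_param|exact: polyfun_const].
  have /choice[P PE] := entry.
  exists (fun s : T => \det (\matrix_(i, j) P (i, s j))).
  have FE (w : 'rV[K]_D) (s : T) : (\det (\matrix_(i, j) P (i, s j))).@[fun i => w 0 i] =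
      minor (A (param w)) s.
    rewrite -det_map_mx /minor; congr (\det _); apply/matrixP => i j.
    rewrite [LHS]mxE /= !mxE; move: (PE (i, s j) w); rewrite mxE => ->.
    by [].
  have c0 (w : 'rV[K]_D) e : param w e 0%N = 1 by case: (param_norm w).
  split; first by exists piv; rewrite FE minor_pivots ?oner_neq0.
  move=> w _; rewrite (_ : (fun s => _) = minor (A (param w))); last by apply/funext => s; rewrite FE.
  exact: (plucker_std DeltaC offE LE CL).
- move=> i M' XM.
  have /andP[rkp _] := position_free i; set rk := position i in rkp.
  have [P [Ph PE]] : exists P : {mpoly K[#|{: T}|]}, P \is 1.-homog /\
      forall c, normalized c -> forall v, @plucker_coord K N k (shift s0 (gen_module c)) v ->
      hev P v = fcoord c rk.1 rk.2 * v piv.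
    have hevX (s : T) (v : T -> K) : hev 'X_(enum_rank s) v = v s.
      by rewrite /hev mevalXU enum_rankK.
    have [s sE] := ratio_coef rkp; rewrite /free_coord.
    case: (rk.1 %% p == root rk.1 rk.2)%N.
      exists 'X_(enum_rank s); split; first by rewrite dhomogX /= mdeg1.
      by move=> c cN v vM; rewrite hevX (sE c).
    have rp : vertex gen (root rk.1 rk.2) rk.2.
      apply: (root_vertex m n_gt0 d_gt0 gen_per _ rkp); exact: same_block_refl.
    have [s' s'E] := ratio_coef rp.
    exists ('X_(enum_rank s) - 'X_(enum_rank s')); split.
      by apply: rpredB; rewrite dhomogX /= mdeg1.
    move=> c cN v vM; rewrite /hev mevalB -!/(hev _ _) !hevX (sE c)// (s'E c)//.
    by rewrite mulrBl.
  have hevX (s : T) (v : T -> K) : hev 'X_(enum_rank s) v = v s.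
    by rewrite /hev mevalXU enum_rankK.
  exists 1%N, P, 'X_(enum_rank piv); split=> //.
  + by rewrite dhomogX /= mdeg1.
  + have [cN cS ME] := cofP _ XM; have [c0 _ _] := cN.
    exists (minor (A (cof M'))).
      by rewrite {1}ME; exact: (plucker_std DeltaC offE LE CL).
    by rewrite hevX minor_pivots// oner_neq0.
  + move=> M'' v XM'' vM''; rewrite hevX => vp.
    have [cN cS ME] := cofP _ XM''; rewrite mxE.
    by rewrite (PE (cof M''))// -?ME// mulfK.
Qed.

End Window.

End Assembly.

Theorem theorem1p6 (R : realType) (m n d : nat)
    (m_gt0 : (0 < m)%N) (n_gt0 : (0 < n)%N) (d_gt0 : (0 < d)%N)
    (mn_coprime : coprime m n)
    (lambda : R[i]) (lambda_neq0 : lambda != 0)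
    (x y : int -> R[i])
    (xE : x = @monom R[i] (n * d)%N%:Z)
    (y_low : @tpow R[i] (m * d)%N%:Z y)
    (y_lead : y (m * d)%N%:Z = 1)
    (y_next : y (m * d + 1)%N%:Z = lambda)
    (Delta : set nat)
    (Delta_cofinite : cofinite Delta)
    (Delta_invariant : invariant (n * d) (m * d) Delta)
    (a : 'I_d -> 'I_n -> nat)
    (aP : generators_enum Delta a)
    (Delta_admissible : admissible m Delta a) :
  exists N0 : nat, forall N : nat, (N0 <= N)%N ->
    exists k : nat,
      isomorphic_to_affine_space (@plucker_coord R[i] N k)
        (JC_stratum x y Delta N) (stratum_dim m Delta a).
Proof.
have [C DeltaC] := cofinite_bound Delta_cofinite.
have gen_adm := admissible_least n_gt0 d_gt0 Delta_cofinite Delta_invariant aP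
  Delta_admissible.
have lead : n%:R * y (m * d + 1)%N%:Z != 0.
  by rewrite y_next mulf_neq0// pnatr_eq0 -lt0n.
pose s := jac_shift x y Delta C (n * d * (m * (n * d)).+1)%N.
exists (C + absz s)%N => N N_large.
exists (size (rows Delta (N + N - absz (N%:Z + s)%R)%N)).
rewrite (stratum_dim_free Delta_invariant m_gt0 mn_coprime aP gen_adm) -card_free_set.
exact: (stratum_isomorphic_affine m_gt0 n_gt0 d_gt0 mn_coprime xE y_low y_lead lead
  (least_per n_gt0 d_gt0 Delta_cofinite) (least_mod n_gt0 d_gt0 Delta_cofinite)
  (least_inv n_gt0 d_gt0 Delta_cofinite Delta_invariant)
  (DeltaE n_gt0 d_gt0 Delta_cofinite Delta_invariant) gen_adm DeltaC N_large).
Qed.
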